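(* Let $y\in(0,\infty)$ and let $(p(n))_{n\ge 1}$ be a sequence of positive integers with $\lim_{n\to\infty} p(n)/n = y$. For each $n$, let $Y(n)$ be an isotropic random vector in $\mathbb{R}^{p(n)}$. On a common probability space, let $(X_k(n))_{1\le k\le n,\ n\ge 1}$ be an array of random vectors such that, for each $n$, $X_1(n),\dots,X_n(n)$ are independent copies of $Y(n)$. Assume that there exists an integer $\ell\ge 1$ such that, as $n\to\infty$, $$\mathbb{E}\big|\,\|Y(n)\|-1\,\big|^{2\ell}=O\big(p(n)^{-1}\big),$$ and that for any $\varepsilon>0$, $$\lim_{n\to\infty}\mathbb{P}\Big(\max_{1\le i\ne j\le n}\max\Big\{\big|\,\|X_i(n)-X_j(n)\|^2-2\,\big|,\ \big|\,\|X_i(n)\|^2-1\,\big|\Big\}\le\varepsilon\Big)=1.$$ Let $f:[0,\infty)\to\mathbb{R}$ be a measurable function which is $\ell$ times differentiable at $2$, and let $A(n)$ be the $n\times n$ real symmetric matrix with entries $A(n)_{ij}=f(\|X_i(n)-X_j(n)\|^2)$ for $1\le i,j\le n$. Let $X(n)$ be the $p(n)\times n$ matrix with columns $X_1(n),\dots,X_n(n)$, and let $\mu_n$ be the law of the random variable $f(0)-f(2)+2f'(2)-2f'(2)S_n$, where $S_n$ has distribution $\mathbb{E}\mu_{X(n)^TX(n)}$. Then, almost surely, the sequences $(\mu_{A(n)})_n$ and $(\mu_n)_n$ are asymptotically weakly equal.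
   Context: $\|\cdot\|$ denotes the Euclidean norm. A random vector $Y$ in $\mathbb{R}^p$ is isotropic if $\mathbb{E}Y=0$ and $\mathbb{E}[YY^T]=I/p$, where $I$ is the $p\times p$ identity matrix (note the normalization by $1/p$). For a real symmetric $n\times n$ matrix $B$ with eigenvalues $\lambda_1(B),\dots,\lambda_n(B)$, the empirical spectral distribution is $\mu_B=\frac1n\sum_{i=1}^n\delta_{\lambda_i(B)}$. For a random symmetric matrix $B$, $\mathbb{E}\mu_B$ is the deterministic probability measure defined by $\int g\,d\,\mathbb{E}\mu_B=\mathbb{E}\int g\,d\mu_B$ for bounded measurable $g$. Two sequences of probability measures $(\mu_n)$, $(\nu_n)$ on $\mathbb{R}$ are asymptotically weakly equal if for any bounded continuous function $g:\mathbb{R}\to\mathbb{R}$, $\int g\,d\mu_n-\int g\,d\nu_n$ converges to $0$ as $n\to\infty$. No assumption is made on the joint distribution of the rows $(X_1(n),\dots,X_n(n))$ for different values of $n$. The function $f$ does not depend on $n$. *)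

(* Defs.v *)
From HB Require Import structures.
From mathcomp Require Import all_boot all_order all_algebra.
From mathcomp Require Import complex.
From mathcomp Require Import all_classical all_reals all_analysis.

Set Implicit Arguments.
Unset Strict Implicit.
Unset Printing Implicit Defensive.

Import Order.TTheory GRing.Theory Num.Theory.
Import numFieldNormedType.Exports.

Local Open Scope classical_set_scope.
Local Open Scope ring_scope.

(* The canonical norm of MathComp-Analysis on matrices is the sup norm. *)
Definition enorm (R : realType) (p : nat) (v : 'cV[R]_p) : R :=
  Num.sqrt (\sum_(i < p) v i ord0 ^+ 2).

(* The Borel sigma-algebra; the type is convertible to 'cV[R]_p. *)
Notation borelcV R p := (g_sigma_algebraType [set U : set 'cV[R]_p | open U]).

Section random_vectors.
Context d (T : measurableType d) (R : realType) (P : probability T R).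

(* No separate integrability clause is needed: the diagonal entries of the
   second identity already force every coordinate of Y to be in L^2. *)
Definition isotropic (p : nat) (Y : T -> 'cV[R]_p) : Prop :=
  (forall i, 'E_P[fun w => Y w i ord0] = 0)%E /\
  (forall i j, 'E_P[fun w => (Y w *m (Y w)^T) i j] =
               ((p%:R^-1 *: 1%:M : 'M[R]_p) i j)%:E)%E.

Definition independent_family d' (E : measurableType d') (n : nat)
    (X : 'I_n -> T -> E) : Prop :=
  forall (J : {set 'I_n}) (B : 'I_n -> set E), (forall i, measurable (B i)) ->
    P (\bigcap_(i in [set` J]) (X i @^-1` B i)) =
    (\prod_(i in J) P (X i @^-1` B i))%E.

End random_vectors.

(* k times differentiable at a point, for k >= 1: the derivatives of order < k
   exist around the point and the one of order k exists at the point. *)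
Definition times_differentiable_at (R : realType) (k : nat) (f : R -> R)
    (a : R) : Prop :=
  (forall j, (j.+1 < k)%N -> \forall x \near a, derivable (derive1n j f) x 1) /\
  derivable (derive1n k.-1 f) a 1.

Section spectrum.
Context (R : realType).

(* The eigenvalues, in nondecreasing order and repeated according to their
   multiplicity; meaningful when the characteristic polynomial splits over R. *)
Definition eigenvalues (n : nat) (B : 'M[R]_n) : seq R :=
  xget [::] [set s : seq R | sorted <=%R s /\
                             char_poly B = \prod_(x <- s) ('X - x%:P)].

Lemma char_poly_conj (F : fieldType) (n : nat) (P D : 'M[F]_n) :
  P \in unitmx -> char_poly (invmx P *m D *m P) = char_poly D.
Proof.
move=> uP; have PcK : map_mx polyC (invmx P) *m map_mx polyC P = 1%:M.
  by rewrite -map_mxM mulVmx// map_mx1.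
rewrite /char_poly; have -> : char_poly_mx (invmx P *m D *m P) =
    map_mx polyC (invmx P) *m char_poly_mx D *m map_mx polyC P.
  rewrite /char_poly_mx mulmxBr mulmxBl !map_mxM; congr (_ - _).
  by rewrite mul_mx_scalar -scalemxAl PcK scalemx1.
rewrite !det_mulmx mulrC mulrA [\det (map_mx _ P) * _]mulrC -det_mulmx PcK.
by rewrite det1 mul1r.
Qed.

Lemma eigenvaluesP (n : nat) (B : 'M[R]_n) : B^T = B ->
  [/\ size (eigenvalues B) = n, sorted <=%R (eigenvalues B) &
      char_poly B = \prod_(x <- eigenvalues B) ('X - x%:P)].
Proof.
move=> symB.
have /(xgetPex [::]) : exists s : seq R, sorted <=%R s /\
    char_poly B = \prod_(x <- s) ('X - x%:P).
  pose c := complex.real_complex R.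
  pose Bc : 'M[complex.complex R]_n := map_mx c B.
  have hBc : Bc \is hermsymmx.
    apply: realsym_hermsym.
      by apply/is_hermitianmxP/matrixP => i j; rewrite !mxE mul1r -{1}symB mxE.
    apply/mxOverP => i j; rewrite mxE; apply/complex.complex_realP.
    by exists (B i j).
  have /mxOverP Dreal := hermitian_spectral_diag_real hBc.
  have /orthomx_spectralP BcE := hermitian_normalmx hBc.
  pose s := [seq complex.Re (spectral_diag Bc 0 i) | i : 'I_n].
  exists (sort <=%R s); split; first exact/sort_sorted/le_total.
  rewrite (perm_big s) ?perm_sort//=.
  apply: (@map_poly_inj _ _ c).
  rewrite rmorph_prod map_char_poly -/Bc BcE char_poly_conj ?spectral_unit//.
  rewrite char_poly_trig ?diag_mx_is_trig// big_image/=.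
  apply: eq_bigr => i _; rewrite mxE eqxx mulr1n rmorphB/= map_polyX map_polyC/=.
  by rewrite /c complex.RRe_real.
rewrite -/(eigenvalues B) => -[ssort sE].
split => //; have := size_char_poly B; rewrite sE size_prod_XsubC.
by move=> [].
Qed.

Definition esd (n : nat) (B : 'M[R]_n) :
    {measure set (measurableTypeR R) -> \bar R} :=
  mscale (n%:R^-1)%:nng
    (msum (fun i => \d_((eigenvalues B)`_i : measurableTypeR R)) n).

(* E mu_B, obtained by taking g to be the indicator of A in
   \int g d(E mu_B) = E \int g d(mu_B). *)
Definition mean_esd d (T : measurableType d) (P : probability T R) (n : nat)
    (B : T -> 'M[R]_n) : set (measurableTypeR R) -> \bar R :=
  fun A => (\int[P]_w esd (B w) A)%E.

Definition asymptotically_weakly_equal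
    (mu nu : nat -> set (measurableTypeR R) -> \bar R) : Prop :=
  forall g : R -> R, continuous g -> (exists M : R, forall x, `|g x| <= M) ->
    (fun n => (\int[mu n]_x (g x)%:E - \int[nu n]_x (g x)%:E)%E)
      @ \oo --> 0%E.

End spectrum.

(* Main.v *)
(* Write r_ij = |X_i - X_j|^2 - 2 = a_i + a_j - 2 b_ij with a_i = |X_i|^2 - 1 and
   b_ij = <X_i, X_j>.  Let P be the Taylor polynomial of f at 2 in the variable
   r, and c its linear coefficient.  On the event where all a_i and r_ij are
   small, f(2 + r_ij) differs from P(a_i + a_j) - 2 c b_ij by o(|r_ij|^l) +
   o(|b_ij|).  The matrix P(a_i + a_j) has rank at most deg P + 1, and the error
   matrix has Hilbert-Schmidt norm o(sqrt n) in mean square, because both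
   E | |Y| - 1 |^(2l) and E <X_i, X_j>^2 = 1/p are O(1/n).  Hence A is a bounded
   rank perturbation plus a small Hilbert-Schmidt perturbation of
   (f 0 - f 2 + 2 c) I - 2 c X^T X, and eigenvalue counting functions of the two
   matrices agree up to a small shift, first in expectation.

   The passage from expectations to almost sure statements is McDiarmid's
   inequality followed by Borel-Cantelli: replacing one vector X_i modifies a
   single row and column of A, hence changes the counting function by at most 2. *)

Require Import Defs.
From HB Require Import structures.
From mathcomp Require Import all_boot all_order all_algebra.
From mathcomp Require Import complex.
From mathcomp Require Import all_classical all_reals all_analysis.
From mathcomp Require Import measurable_realfun.
From mathcomp Require Import ring lra zify.

Set Implicit Arguments.
Unset Strict Implicit.
Unset Printing Implicit Defensive.

Import Order.TTheory GRing.Theory Num.Theory.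
Import numFieldNormedType.Exports.

Local Open Scope classical_set_scope.
Local Open Scope ring_scope.

(** * Spectral counting functions *)

Section spectral_decomposition.
Context (R : realType).
Local Open Scope sesquilinear_scope.
Local Notation C := (complex.complex R).
Local Notation c := (complex.real_complex R).

(** The event where all a_i and r_ij are small has probability tending to 1, but with no rate, so
    the matrix comparison does not by itself give an almost sure statement. It is integrated
    instead: counting functions divided by n lie in [0, 1], hence the bad event costs at most its
    probability. The concentration bound is geometric in n, and therefore summable whatever the
    joint law across n is.

    The exponent 2l is forced by squaring the Taylor error o(|r|^l): r^(2l) is controlled by terms
    of mean O(1/n), and the n^2 pairs contribute o(n). The moment hypothesis only makes a_i of order
    n^(-1/(2l)), too large to linearise in; P is therefore kept whole in a_i + a_j, at the price of
    a rank independent of n, and only b_ij is linearised.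

    Neither sequence of measures need converge. Distribution functions are compared up to a
    horizontal shift, which absorbs the Hilbert-Schmidt error and lets rational thresholds suffice
    for the almost sure part. Tightness is proved on the deterministic side, from a second moment of
    the spectrum, and passes to the random side. *)

Definition spectral_data n (B : 'M[R]_n) (S : 'M[C]_n) (d : 'I_n -> R) :=
  S \is unitarymx /\ map_mx c B = invmx S *m diag_mx (\row_i c (d i)) *m S.

Lemma spectral_data_eigenvalues n (B : 'M[R]_n) S d : B^T = B ->
  spectral_data B S d -> perm_eq (eigenvalues B) (map d (enum 'I_n)).
Proof.
move=> symB [uS BE]; have [_ _ cB] := eigenvaluesP symB.
apply: prod_XsubC_eq; rewrite -cB; apply: (@map_poly_inj _ _ c).
rewrite map_char_poly BE char_poly_conj ?unitarymx_unit//.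
rewrite char_poly_trig ?diag_mx_is_trig// rmorph_prod big_map big_enum/=.
apply: eq_bigr => i _.
by rewrite !mxE eqxx mulr1n rmorphB/= map_polyX map_polyC.
Qed.

Lemma spectral_dataP n (B : 'M[R]_n) : B^T = B ->
  exists S d, spectral_data B S d.
Proof.
move=> symB; pose Bc : 'M[C]_n := map_mx c B.
have hBc : Bc \is hermsymmx.
  apply: realsym_hermsym.
    by apply/is_hermitianmxP/matrixP => i j; rewrite !mxE mul1r -{1}symB mxE.
  apply/mxOverP => i j; rewrite mxE; apply/complex.complex_realP.
  by exists (B i j).
have /mxOverP Dreal := hermitian_spectral_diag_real hBc.
have /orthomx_spectralP BcE := hermitian_normalmx hBc.
exists (spectralmx Bc), (fun i => complex.Re (spectral_diag Bc 0 i)).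
split; first exact: spectral_unitarymx.
rewrite -/Bc {1}BcE; congr (_ *m diag_mx _ *m _).
by apply/rowP => i; rewrite !mxE complex.RRe_real.
Qed.

Lemma spectral_data_affine n (B : 'M[R]_n) S d a b : spectral_data B S d ->
  spectral_data (a%:M + b *: B) S (fun i => a + b * d i).
Proof.
move=> [uS BE]; split => //.
rewrite map_mxD map_scalar_mx map_mxZ BE.
have -> : diag_mx (\row_i c (a + b * d i)) =
    (c a)%:M + c b *: diag_mx (\row_i c (d i)) :> 'M[C]_n.
  apply/matrixP => i j; rewrite !mxE; case: eqVneq => // _.
    by rewrite /= ?mulr1n rmorphD rmorphM.
  by rewrite !mulr0n mulr0 addr0.
rewrite mulmxDr mulmxDl mul_mx_scalar -scalemxAl mulVmx ?unitarymx_unit//.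
by rewrite scalemx1 -scalemxAr -scalemxAl.
Qed.

Lemma eigenvalues_affine n (B : 'M[R]_n) a b : B^T = B ->
  perm_eq (eigenvalues (a%:M + b *: B)) [seq a + b * x | x <- eigenvalues B].
Proof.
move=> symB; have [S [d Sd]] := spectral_dataP symB.
have symB' : (a%:M + b *: B)^T = a%:M + b *: B.
  by rewrite linearD/= tr_scalar_mx linearZ/= symB.
apply: (perm_trans (spectral_data_eigenvalues symB' (spectral_data_affine a b Sd))).
rewrite perm_sym; have := spectral_data_eigenvalues symB Sd.
by move=> /(perm_map (fun x => a + b * x)); rewrite -map_comp.
Qed.

(** The vectors are complex because the diagonalising matrix is a complex unitary one. *)
Definition qform n (B : 'M[R]_n) (v : 'rV[C]_n) : C :=
  (v *m map_mx c B *m v ^t*) 0 0.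

Lemma qformD n (A B : 'M[R]_n) v : qform (A + B) v = qform A v + qform B v.
Proof. by rewrite /qform map_mxD mulmxDr mulmxDl mxE. Qed.

Lemma qformE n (B : 'M[R]_n) S d v : spectral_data B S d ->
  qform B v = \sum_i c (d i) * `|(v *m S ^t*) 0 i| ^+ 2.
Proof.
move=> [uS BE]; rewrite /qform BE invmx_unitary//.
set u := v *m S ^t*.
have uE : S *m v ^t* = u ^t* by rewrite /u trmx_mul map_mxM trmxCK.
rewrite !mulmxA -/u -[u *m _ *m S *m _]mulmxA uE mxE; apply: eq_bigr => i _.
rewrite mul_mx_diag !mxE normCK; ring.
Qed.

Lemma qform1E n (B : 'M[R]_n) S d v : spectral_data B S d ->
  qform 1%:M v = \sum_i `|(v *m S ^t*) 0 i| ^+ 2.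
Proof.
move=> Sd; rewrite (@qformE _ _ S (fun=> 1)); last first.
  (* The identity is [1 + 0 * B], so the same [S] diagonalises it, with all eigenvalues 1. *)
  have := spectral_data_affine 1 0 Sd; rewrite scale0r addr0.
  by congr (spectral_data _ _ _); apply/funext => i; rewrite mul0r addr0.
by apply: eq_bigr => i _; rewrite rmorph1 mul1r.
Qed.

(* [K] imposes one linear equation on [v] for each eigenvalue in [p]. *)
Lemma eigen_constraints n (B : 'M[R]_n) S d (p : pred R) : B^T = B ->
  spectral_data B S d ->
  exists K : 'M[C]_(n, count p (eigenvalues B)),
    forall v : 'rV_n, v *m K = 0 ->
    forall i, p (d i) -> (v *m S ^t*) 0 i = 0.
Proof.
move=> symB Sd; have /permP -> := spectral_data_eigenvalues symB Sd.
have -> : count p [seq d i | i <- enum 'I_n] = #|[pred i | p (d i)]|.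
  by rewrite count_map cardE -size_filter enumT /enum_mem.
exists (colsub (fun k => enum_val k) (S ^t*)) => v vK i pi.
have ii : i \in [pred i | p (d i)] by rewrite inE.
have := congr1 (fun M : 'rV__ => M 0 (enum_rank_in ii i)) vK.
rewrite !mxE => sE; rewrite -[RHS]sE; apply: eq_bigr => j _.
by rewrite [in RHS]mxE enum_rankK_in.
Qed.

Lemma left_kernel_nontrivial m n (K : 'M[C]_(n, m)) : (m < n)%N ->
  exists2 v : 'rV[C]_n, v != 0 & v *m K = 0.
Proof.
move=> mn; have : kermx K != 0.
  by rewrite kermx_eq0 /row_free neq_ltn (leq_ltn_trans (rank_leq_col K) mn).
move=> Kn0; exists (nz_row (kermx K)); first by rewrite nz_row_eq0.
by apply/eqP; rewrite -sub_kermx nz_row_sub.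
Qed.

(** Divided by [n], this is the distribution function of the empirical spectral distribution. As an
    integer it makes error terms smaller than 1 disappear. *)
Definition below n (B : 'M[R]_n) (t : R) := count (fun x => x <= t) (eigenvalues B).

(* If the inequality failed, the linear constraints attached to the four terms
   would have a common nonzero solution [v], and then both
   [qform A v <= t * qform 1%:M v] and the opposite strict inequality. *)
Lemma below_perturb n (A B E : 'M[R]_n) (t k : R) : A^T = A -> B^T = B -> E^T = E ->
  (below A t <= below B (t + k)%R + \rank (A - B - E)%R +
                count (fun x => x < - k)%R (eigenvalues E))%N.
Proof.
move=> sA sB sE.
have [SA [dA hA]] := spectral_dataP sA.
have [SB [dB hB]] := spectral_dataP sB.
have [SE [dE hE]] := spectral_dataP sE.
have [KA KAP] := eigen_constraints (predC (fun x => x <= t)) sA hA.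
have [KB KBP] := eigen_constraints (fun x => x <= t + k) sB hB.
have [KE KEP] := eigen_constraints (fun x => x < - k) sE hE.
(* [col_base] has as many columns as the rank, so killing the form of [L] at [v] costs exactly
   [\rank L] equations. *)
set L := A - B - E; pose KL := col_base (map_mx c L).
rewrite leqNgt; apply/negP => lt.
have szA : size (eigenvalues A) = n by case: (eigenvaluesP sA).
have [] := @left_kernel_nontrivial _ _ (row_mx (row_mx KA KB) (row_mx KE KL)).
  move: lt; rewrite /below -/L -(mxrank_map c L).
  have := count_predC (fun x => x <= t) (eigenvalues A); rewrite szA.
  move=> nE lt; rewrite -[ltnRHS]nE.
  have aux (a b r e m : nat) : (b + r + e < a -> m + b + (e + r) < a + m)%N by lia.
  exact: aux lt.
move=> v v0; rewrite !mul_mx_row.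
move=> /eqP; rewrite row_mx_eq0 !row_mx_eq0 => /andP[/andP[/eqP vA /eqP vB]].
move=> /andP[/eqP vE /eqP vL].
have qL : qform L v = 0.
  by rewrite /qform -(mulmx_base (map_mx c L)) mulmxA vL mul0mx mul0mx mxE.
have qA : qform A v <= c t * qform 1%:M v.
  rewrite (qformE _ hA) (qform1E _ hA) mulr_sumr ler_sum// => i _.
  have [dt|dt] := boolP (dA i <= t).
    by rewrite ler_wpM2r ?exprn_ge0// lecR.
  by rewrite (KAP v vA)// normr0 expr0n/= !mulr0.
have qE : - c k * qform 1%:M v <= qform E v.
  rewrite (qformE _ hE) (qform1E _ hE) mulr_sumr ler_sum// => i _.
  have [dt|dt] := ltP (dE i) (- k); last first.
    by rewrite ler_wpM2r ?exprn_ge0// -rmorphN lecR.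
  by rewrite (KEP v vE)// normr0 expr0n/= !mulr0.
have q1 : 0 < qform 1%:M v.
  rewrite /qform map_mx1 mulmx1 -dotmxE.
  exact: dotmx_is_dotmx.
have qB : c (t + k) * qform 1%:M v < qform B v.
  have q1' := q1.
  rewrite (qform1E _ hB) in q1'.
  rewrite (qformE _ hB) (qform1E _ hB) mulr_sumr -subr_gt0 -sumrB.
  have ge0 i : 0 <= c (dB i) * `|(v *m SB ^t*) 0 i| ^+ 2 -
                    c (t + k) * `|(v *m SB ^t*) 0 i| ^+ 2.
    rewrite subr_ge0; have [dt|dt] := leP (dB i) (t + k).
      by rewrite (KBP v vB)// normr0 expr0n/= !mulr0.
    by rewrite ler_wpM2r ?exprn_ge0// lecR ltW.
  rewrite lt_neqAle sumr_ge0 ?andbT//; apply/eqP => /esym/psumr_eq0P q0.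
  move: q1'; rewrite big1 ?ltxx// => i _.
  have [dt|dt] := leP (dB i) (t + k).
    by rewrite (KBP v vB)// normr0 expr0n.
  have /eqP := q0 (fun i _ => ge0 i) i isT.
  by rewrite -mulrBl mulf_eq0 -rmorphB fmorph_eq0 subr_eq0 gt_eqF//= => /eqP.
have : qform A v = qform B v + qform E v + qform L v.
  by rewrite -!qformD /L; congr qform; apply/matrixP => i j; rewrite !mxE; ring.
rewrite qL addr0 => qABE.
have := ltr_leD qB qE; rewrite -qABE => /lt_le_trans/(_ qA).
by rewrite rmorphD/= mulrDl mulNr addrK ltxx.
Qed.

End spectral_decomposition.

(** * Hilbert-Schmidt norms and measurability of spectral counts *)

Section counting.
Context (R : realType).
Local Notation C := (complex.complex R).
Local Notation c := (complex.real_complex R).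

Definition sqnorm m n (B : 'M[R]_(m, n)) : R := \sum_i \sum_j B i j ^+ 2.

(** Both sides are the trace of [B *m B], read from the entries and from a unitary
    diagonalisation. *)
Lemma sqnorm_eigenvalues n (B : 'M[R]_n) : B^T = B ->
  sqnorm B = \sum_(x <- eigenvalues B) x ^+ 2.
Proof.
move=> symB; have [S [d Sd]] := spectral_dataP symB.
rewrite (perm_big _ (spectral_data_eigenvalues symB Sd))/= big_map big_enum/=.
apply: (@complexI R).
have -> : sqnorm B = \tr (B *m B).
  apply: eq_bigr => i _; rewrite mxE; apply: eq_bigr => j _.
  by rewrite expr2 -[in X in _ * X]symB mxE.
have [uS BE] := Sd.
rewrite [LHS](_ : _ = \tr (map_mx c (B *m B))); last first.
  by rewrite /mxtrace rmorph_sum; apply: eq_bigr => i _; rewrite [RHS]mxE.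
rewrite map_mxM BE !mulmxA mulmxK ?unitarymx_unit// mxtrace_mulC !mulmxA.
rewrite mulmxV ?unitarymx_unit// mul1mx rmorph_sum; apply: eq_bigr => i _.
by rewrite mul_diag_mx !mxE eqxx mulr1n rmorphXn expr2.
Qed.

(** Chebyshev's inequality for the spectrum: each counted eigenvalue adds at least [k ^+ 2] to the
    sum of squares. *)
Lemma count_eigenvalues_sqnorm n (B : 'M[R]_n) k (p : pred R) : B^T = B ->
  0 <= k -> (forall x, p x -> k <= `|x|) ->
  (count p (eigenvalues B))%:R * k ^+ 2 <= sqnorm B.
Proof.
move=> symB k0 pk; rewrite sqnorm_eigenvalues// -sum1_count natr_sum mulr_suml.
rewrite big_mkcond; apply: ler_sum => x _.
case: ifP => [/pk kx|_]; last exact: sqr_ge0.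
by rewrite mul1r -[x ^+ 2]real_normK ?num_real// lerXn2r ?nnegrE.
Qed.

(** The form used from here on: [E] is the part paid for by its Hilbert-Schmidt norm, [A - B - E]
    the part paid for by its rank. A larger shift [k] makes [E] cheaper. *)
Lemma below_perturb_sqnorm n (A B E : 'M[R]_n) (t k : R) :
  A^T = A -> B^T = B -> E^T = E -> 0 < k ->
  (below A t)%:R <= (below B (t + k))%:R + (\rank (A - B - E))%:R +
                    sqnorm E / k ^+ 2.
Proof.
move=> sA sB sE k0; have /(_ t k) := below_perturb _ _ sA sB sE.
rewrite -(ler_nat R) !natrD => /le_trans; apply; rewrite lerD2l.
rewrite ler_pdivlMr ?exprn_gt0//; apply: count_eigenvalues_sqnorm => //.
  exact: ltW.
by move=> x xk; rewrite ler_normr; apply/orP; right; rewrite lerNr ltW.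
Qed.

Lemma below_mono n (B : 'M[R]_n) s t : s <= t -> (below B s <= below B t)%N.
Proof. by move=> st; apply: sub_count => x /= /le_trans; exact. Qed.

Lemma below_le n (B : 'M[R]_n) t : B^T = B -> (below B t <= n)%N.
Proof. by move=> /eigenvaluesP[sz _ _]; rewrite -[leqRHS]sz count_size. Qed.

Lemma seq_gap_above (s : seq R) t :
  exists2 e, 0 < e & {in s, forall x, x <= t + e -> x <= t}.
Proof.
elim: s => [|x s [e e0 IH]]; first by exists 1.
have [xt|tx] := leP x t.
  exists e => // y; rewrite inE => /predU1P[->//|]; exact: IH.
exists (Num.min e ((x - t) / 2)).
  by rewrite lt_min e0 divr_gt0// subr_gt0.
move=> y; rewrite inE => /predU1P[->|ys] yt.
  have : x <= t + (x - t) / 2.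
    by rewrite (le_trans yt)// lerD2l ge_min lexx orbT.
  by move: tx; lra.
by apply: IH => //; rewrite (le_trans yt)// lerD2l ge_min lexx.
Qed.

(** A finite spectrum leaves a gap above [t]. This is what removes, or makes room for, a shift of
    the threshold. *)
Lemma below_right_constant n (B : 'M[R]_n) t :
  exists2 e, 0 < e & below B (t + e) = below B t.
Proof.
have [e e0 sP] := seq_gap_above (eigenvalues B) t.
exists e => //; apply: eq_in_count => x xs /=.
apply/idP/idP; first exact: sP.
by move=> /le_trans; apply; rewrite lerDl ltW.
Qed.

Definition rat_mx n (M : 'M[rat]_n) : 'M[R]_n := map_mx ratr M.

Lemma rat_mx_approx n (B : 'M[R]_n) (e : R) : B^T = B -> 0 < e ->
  exists2 M : 'M[rat]_n, M^T = M & sqnorm (B - rat_mx M) < e.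
Proof.
(* [h <= 1] bounds a squared entry by the absolute value of the entry, and [n * n] terms
   [e / (n * n).+1%:R] add up to less than [e]. *)
move=> symB e0; pose h : R := Num.min 1 (e / (n * n).+1%:R).
have h0 : 0 < h by rewrite lt_min ltr01/= divr_gt0.
have ex x : exists q : rat, `|x - ratr q| < h.
  have [q] := @rat_in_itvoo R (x - h) (x + h) ltac:(lra).
  by rewrite in_itv/= => /andP[xq qx]; exists q; rewrite ltr_norml; lra.
have [q qP] := choice ex.
pose M : 'M[rat]_n := \matrix_(i, j) if (i <= j)%N then q (B i j) else q (B j i).
have symBE i j : B i j = B j i by rewrite -{1}symB mxE.
exists M.
  apply/matrixP => i j; rewrite !mxE; case: ltngtP => //= ij.
  by rewrite (val_inj ij).
have entry i j : `|(B - rat_mx M) i j| < h.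
  by rewrite !mxE; case: ifP => // _; rewrite symBE.
apply: (@le_lt_trans _ _ (\sum_(i < n) \sum_(j < n) (e / (n * n).+1%:R))).
  apply: ler_sum => i _; apply: ler_sum => j _; rewrite -real_normK ?num_real//.
  have h1 : h <= 1 by rewrite ge_min lexx.
  have he : h <= e / (n * n).+1%:R by rewrite ge_min lexx orbT.
  rewrite (le_trans _ he)// (le_trans _ (ltW (entry i j)))// expr2 ler_piMr//.
  by rewrite (le_trans (ltW (entry i j))).
rewrite !sumr_const !card_ord -mulrnA -[X in X < _]mulr_natr mulrAC ltr_pdivrMr//.
by rewrite ltr_pM2l// ltr_nat.
Qed.

Lemma measurable_set_ltr d (T : measurableType d) (f g : T -> R) :
  measurable_fun setT f -> measurable_fun setT g ->
  measurable [set w | f w < g w].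
Proof.
move=> mf mg; have := measurable_fun_ltr mf mg.
by move=> /(_ measurableT [set true] I); rewrite setTI.
Qed.

Lemma measurable_set_ler d (T : measurableType d) (f g : T -> R) :
  measurable_fun setT f -> measurable_fun setT g ->
  measurable [set w | f w <= g w].
Proof.
move=> mf mg; have := measurable_fun_ler mf mg.
by move=> /(_ measurableT [set true] I); rewrite setTI.
Qed.

(** [eigenvalues] comes from a choice, so no formula shows its measurability. Stability of the count
    under small Hilbert-Schmidt perturbations reduces the event to countably many conditions on the
    entries. *)
Lemma measurable_below d (T : measurableType d) n (B : T -> 'M[R]_n) t k :
  (forall w, (B w)^T = B w) ->
  (forall i j, measurable_fun setT (fun w => B w i j)) ->
  measurable [set w | (below (B w) t < k)%N].
Proof.
move=> symB mB.
pose r (m : nat) : R := m.+1%:R^-1.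
have r0 m : 0 < r m by rewrite invr_gt0.
pose good (q : nat * 'M[rat]_n) :=
  q.2^T = q.2 /\ (below (rat_mx q.2) (t + r q.1) < k)%N.
(* [below (B w) t < k] holds exactly when it holds, with some room [r m], for a
   rational symmetric matrix that is [r m]-close to [B w]. *)
pose U (q : nat * 'M[rat]_n) : set T :=
  if `[< good q >] then [set w | sqnorm (B w - rat_mx q.2) < r q.1 ^+ 2]
  else set0.
have -> : [set w | (below (B w) t < k)%N] = \bigcup_q U q.
  apply/seteqP; split => [w/= wk|w [[m M] _]].
    have [e e0 eE] := below_right_constant (B w) t.
    have [m me] : exists m, r m < e / 2.
      have e20 : 0 < e / 2 by rewrite divr_gt0.
      have [m _ mP] := near_infty_natSinv_lt (PosNum e20).
      by exists m; exact: mP (leqnn m).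
    have [M symM MB] := rat_mx_approx (symB w) (exprn_gt0 2 (r0 m)).
    exists (m, M) => //; rewrite /U; case: asboolP => //= -[]; split => //=.
    apply: leq_ltn_trans wk; rewrite -eE.
    have symRM : (rat_mx M)^T = rat_mx M by rewrite /rat_mx map_trmx symM.
    have symE : (rat_mx M - B w)^T = rat_mx M - B w.
      by rewrite linearB/= symRM symB.
    have := below_perturb_sqnorm (t + r m) symRM (symB w) symE (r0 m).
    rewrite subrr mxrank0 addr0 => h.
    apply: (@leq_trans (below (B w) (t + r m + r m)%R)); last first.
      by apply: below_mono; move: me; lra.
    (* The error term is strictly below 1 and the counts are integers, so it vanishes. *)
    rewrite -ltnS -(ltr_nat R) -natr1; apply: le_lt_trans h _.
    rewrite ltrD2l ltr_pdivrMr ?exprn_gt0// mul1r; apply: le_lt_trans MB.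
    by do 2 (apply: ler_sum => ? _); rewrite !mxE -sqrrN opprB.
  rewrite /U; case: asboolP => //= -[symM Mk] wM.
  apply: leq_ltn_trans Mk.
  have symRM : (rat_mx M)^T = rat_mx M by rewrite /rat_mx map_trmx symM.
  have symE : (B w - rat_mx M)^T = B w - rat_mx M.
    by rewrite linearB/= symRM symB.
  have := below_perturb_sqnorm t (symB w) symRM symE (r0 m).
  rewrite subrr mxrank0 addr0 => h.
  rewrite -ltnS -(ltr_nat R) -natr1; apply: le_lt_trans h _.
  by rewrite ltrD2l ltr_pdivrMr ?exprn_gt0// mul1r.
apply: countable_bigcupT_measurable; first exact: countableP.
move=> [m M]; rewrite /U; case: asboolP => // _.
apply: measurable_set_ltr => //.
do 2 (apply: measurable_sum => ?); apply: measurable_funX.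
by under eq_fun do rewrite !mxE; apply: measurable_funB.
Qed.

End counting.

(** * Bounded differences *)

Section bounded_functions.
Context d (T : measurableType d) (R : realType) (m : probability T R).

Lemma bounded_integrable (f : T -> R) (M : R) :
  measurable_fun setT f -> (forall x, `|f x| <= M) ->
  m.-integrable setT (EFin \o f).
Proof.
move=> mf fM; apply: measurable_bounded_integrable => //.
  by rewrite /= probability_setT ltry.
exists M; split; first exact: num_real.
by move=> r Mr x _ /=; apply: le_trans (fM x) (ltW Mr).
Qed.

Lemma Rintegral_probability_cst (c : R) : \int[m]_x (cst c x) = c.
Proof. by rewrite Rintegral_cst//= probability_setT mulr1. Qed.

Lemma integral_probability_cst (c : \bar R) : (\int[m]_x (cst c x) = c)%E.
Proof. by rewrite integral_cst//= probability_setT mule1. Qed.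

Lemma Rintegral_bounds (f : T -> R) (a b : R) : measurable_fun setT f ->
  (forall x, a <= f x <= b) -> a <= \int[m]_x f x <= b.
Proof.
move=> mf ab.
have fi : m.-integrable setT (EFin \o f).
  apply: (@bounded_integrable _ (`|a| + `|b|)) => // x; have /andP[] := ab x.
  move=> afx fxb; apply/ler_normlP; move: (ler_norm b) (ler_norm (- a)); rewrite normrN.
  by move: (normr_ge0 a) (normr_ge0 b) => *; split; lra.
have ci c : m.-integrable setT (EFin \o cst c).
  by apply: (@bounded_integrable _ `|c|) => //.
rewrite -{1}(Rintegral_probability_cst a) -{1}(Rintegral_probability_cst b).
by rewrite !le_Rintegral// => x _ /=; have /andP[] := ab x.
Qed.

Lemma EFin_Rintegral (f : T -> R) : m.-integrable setT (EFin \o f) ->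
  (\int[m]_x f x)%:E = (\int[m]_x (f x)%:E)%E.
Proof. by move=> fi; rewrite /Rintegral fineK// integrable_fin_num. Qed.

End bounded_functions.

Section bounded_differences.
Context (R : realType).

(** With [z = x / 2], squaring [expR z <= 1 / (1 - z)] gives a rational bound. It lies below the
    quadratic because [1 - 6 * z + 4 * z ^+ 2] is nonnegative when [z] is at most 1/8. *)
Lemma expR_le_quadratic (x : R) : `|x| <= 4^-1 -> expR x <= 1 + x + x ^+ 2.
Proof.
rewrite ler_norml => /andP[x1 x2].
have h : 1 - x / 2 <= expR (- (x / 2)) by have := expR_ge1Dx (- (x / 2)).
have h0 : 0 < 1 - x / 2 by lra.
have -> : x = x / 2 + x / 2 by lra.
rewrite expRD; set z := x / 2 in h h0 *.
have zE : x = 2 * z by rewrite /z; lra.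
have ez : expR z * (1 - z) <= 1.
  rewrite -[leRHS](expR0 R) -(subrr z) expRD ler_pM2l ?expR_gt0//.
rewrite -(@ler_pM2r _ ((1 - z) ^+ 2)) ?exprn_gt0//.
apply: (@le_trans _ _ 1).
  have -> : expR z * expR z * (1 - z) ^+ 2 = (expR z * (1 - z)) ^+ 2 by ring.
  by rewrite exprn_ile1// mulr_ge0 ?expR_ge0// ltW.
rewrite -subr_ge0.
have -> : (1 + (z + z) + (z + z) ^+ 2) * (1 - z) ^+ 2 - 1 =
  z ^+ 2 * (1 - 6 * z + 4 * z ^+ 2) by ring.
rewrite mulr_ge0 ?sqr_ge0//; have := sqr_ge0 z; lra.
Qed.

(** After the quadratic bound on [expR], the linear term integrates to 0 by centring and the square
    is at most [(s * c) ^+ 2]. Hoeffding's lemma has a better constant, but any constant leads to a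
    geometric tail. *)
Lemma exp_moment_bounded_oscillation d (T : measurableType d) (m : probability T R)
    (h : T -> R) (c s : R) : measurable_fun setT h -> (forall x, 0 <= h x <= 1) ->
  (forall x y, `|h x - h y| <= c) -> `|s| * c <= 4^-1 ->
  (\int[m]_x (expR (s * (h x - \int[m]_x h x)))%:E <= (expR ((s * c) ^+ 2))%:E)%E.
Proof.
move=> mh h01 hc sc; set mu := Rintegral _ _ _.
have hi : m.-integrable setT (EFin \o h).
  apply: (@bounded_integrable _ _ _ _ _ 1) => // x.
  by have /andP[h0 h1] := h01 x; rewrite ger0_norm.
have hmu x : `|h x - mu| <= c.
  have : h x - c <= mu <= h x + c.
    apply: Rintegral_bounds => // y; have := hc x y; rewrite ler_norml; lra.
  by rewrite ler_norml; lra.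
have c0 : 0 <= c.
  (* A space of total mass 1 has a point, and an oscillation bound at that point is nonnegative. *)
  have [t _] : [set: T] !=set0.
    apply/set0P/eqP => T0; have := probability_setT m; rewrite T0 measure0.
    by move=> /eqP; rewrite eqe eq_sym oner_eq0.
  exact: le_trans (hmu t).
have qi : m.-integrable setT (EFin \o (fun x => (1 + (s * c) ^+ 2) + s * (h x - mu))).
  apply: (@bounded_integrable _ _ _ _ _ (1 + (s * c) ^+ 2 + 4^-1)) => [|x].
    apply: measurable_funD => //; apply: measurable_funM => //.
    exact: measurable_funB.
  apply: le_trans (ler_normD _ _) _; rewrite ger0_norm ?addr_ge0 ?sqr_ge0//.
  by rewrite lerD2l normrM (le_trans _ sc)// ler_wpM2l.
apply: (@le_trans _ _ (\int[m]_x ((1 + (s * c) ^+ 2) + s * (h x - mu))%:E)%E).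
  apply: ge0_le_integral => //.
  - apply/measurable_EFinP; apply: measurableT_comp; first exact: measurable_expR.
    by apply: measurable_funM => //; exact: measurable_funB.
  - by case/integrableP: qi.
  move=> x _; rewrite lee_fin.
  have sx : `|s * (h x - mu)| <= `|s| * c by rewrite normrM ler_wpM2l.
  apply: le_trans (expR_le_quadratic (le_trans sx sc)) _.
  rewrite addrAC lerD2r lerD2l -[leLHS]real_normK ?num_real//.
  rewrite -[leRHS]real_normK ?num_real// lerXn2r ?nnegrE//.
  by rewrite normrM [leRHS]normrM (ger0_norm c0) -normrM.
have := EFin_Rintegral qi => /= <-; rewrite lee_fin.
rewrite RintegralD//; last 2 first.
- by apply: (@bounded_integrable _ _ _ _ _ `|1 + (s * c) ^+ 2|).
- apply: (@bounded_integrable _ _ _ _ _ (`|s| * c)) => [|x].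
    by apply: measurable_funM => //; exact: measurable_funB.
  by rewrite normrM ler_wpM2l.
have hmi : m.-integrable setT (EFin \o (fun x => h x - mu)).
  by apply: (@bounded_integrable _ _ _ _ _ c) => //; exact: measurable_funB.
have mui : m.-integrable setT (EFin \o cst mu).
  by apply: (@bounded_integrable _ _ _ _ _ `|mu|).
rewrite RintegralZl// RintegralB// !Rintegral_cst//= probability_setT !mulr1 subrr.
by rewrite mulr0 addr0 expR_ge1Dx.
Qed.

End bounded_differences.

Section product_probability.
Context d1 d2 (T1 : measurableType d1) (T2 : measurableType d2) (R : realType).
Context (m1 : probability T1 R) (m2 : probability T2 R).

Definition product_probability : set (T1 * T2) -> \bar R := (m1 \x m2)%E.

HB.instance Definition _ := Measure.on product_probability.

Let product_probability_setT : product_probability setT = 1%E.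
Proof.
by rewrite /product_probability -setXTT product_measure1E//= !probability_setT mule1.
Qed.

HB.instance Definition _ := Measure_isProbability.Build _ _ _
  product_probability product_probability_setT.

End product_probability.

(** * Product laws on tuples and their exponential moments *)

Section tuple_measure.
Context d (E : measurableType d) (R : realType).

Definition cons_pair n (xt : E * n.-tuple E) : n.+1.-tuple E :=
  [the n.+1.-tuple E of xt.1 :: xt.2].

Lemma measurable_cons_pair n : measurable_fun setT (@cons_pair n).
Proof. by apply: measurable_cons; [exact: measurable_fst|exact: measurable_snd]. Qed.

HB.instance Definition _ n := isMeasurableFun.Build _ _ _ _ (@cons_pair n)
  (@measurable_cons_pair n).

Context (nu : probability E R).

(** The [n]-fold product of [nu]. Adding coordinates in front makes Tonelli's theorem peel off the
    first one, as the induction on [n] requires. *)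
Fixpoint tuple_probability n : probability (n.-tuple E) R :=
  match n with
  | 0 => \d_([tuple] : 0.-tuple E)
  | n'.+1 => distribution (product_probability nu (tuple_probability n'))
                          (@cons_pair n')
  end.

Definition box n (A : 'I_n -> set E) : set (n.-tuple E) :=
  [set t | forall i, A i (tnth t i)].

Lemma measurable_box n (A : 'I_n -> set E) :
  (forall i, measurable (A i)) -> measurable (box A).
Proof.
move=> mA; have -> : box A = \bigcap_i ((fun t => tnth t i) @^-1` A i).
  by apply/seteqP; split => [t tA i _|t tA i]; exact: tA.
apply: fin_bigcap_measurable => [|i _]; first exact: finite_finset.
by rewrite -[X in measurable X]setTI; exact: (measurable_tnth i).
Qed.

Lemma tuple_probability_box n (A : 'I_n -> set E) :
  (forall i, measurable (A i)) ->
  tuple_probability n (box A) = (\prod_(i < n) nu (A i))%E.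
Proof.
elim: n => [|n IH] in A * => mA.
  by rewrite big_ord0 /= diracE mem_set// => -[].
rewrite big_ord_recl -IH//= /distribution /pushforward.
rewrite [X in product_probability _ _ X](_ : _ =
    A ord0 `*` box (fun i => A (lift ord0 i))).
  rewrite /product_probability product_measure1E//.
  exact: measurable_box.
apply/seteqP; split => [[x t] xtA|[x t] [xA tA] i].
  by split; [exact: (xtA ord0)|move=> i; have := xtA (lift ord0 i); rewrite /= tnthS].
by case: (unliftP ord0 i) => [j ->|->]; [rewrite /= tnthS; exact: tA|exact: xA].
Qed.

Lemma measurable_tuple_boxes n : @measurable _ (n.-tuple E) =
  <<s [set box A | A in [set A : 'I_n -> set E | forall i, measurable (A i)]] >>.
Proof.
apply/seteqP; split; last first.
  apply: smallest_sub; first exact: sigma_algebra_measurable.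
  by move=> _ [A mA <-]; exact: measurable_box.
apply: smallest_sub; first exact: smallest_sigma_algebra.
move=> C; rewrite -bigcup_seq/= => -[i _ [B mB <-]].
(* A generator constrains a single coordinate; it is the box with [setT] in all the others. *)
apply: sub_sigma_algebra; exists (fun j => if j == i then B else setT).
  by move=> j /=; case: ifP.
apply/seteqP; split => [t tB|t [_ tB] j].
  by split => //; have := tB i; rewrite eqxx.
by case: eqVneq => // ->.
Qed.

(** Boxes generate the sigma-algebra and are stable under intersection, so a finite measure is
    determined by its values on them. *)
Lemma tuple_probability_unique n (m : {measure set (n.-tuple E) -> \bar R}) :
  (forall A : 'I_n -> set E, (forall i, measurable (A i)) ->
    m (box A) = (\prod_(i < n) nu (A i))%E) ->
  forall B, measurable B -> m B = tuple_probability n B.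
Proof.
move=> mE B mB.
apply: (measure_unique
  [set box A | A in [set A : 'I_n -> set E | forall i, measurable (A i)]]
  (fun=> setT)) => //.
- exact: measurable_tuple_boxes.
- move=> _ _ [A mA <-] [A' mA' <-]; exists (fun i => A i `&` A' i).
    by move=> i; exact: measurableI.
  by apply/seteqP; split => [t tA|t [tA tA'] i]; [split => i; case: (tA i)|split].
- by move=> _; exists (fun=> setT) => //; apply/seteqP; split.
- by apply/seteqP; split => // t _; exists 0%N.
- by move=> _ [A mA <-]; exact: etrans (mE _ mA) (esym (tuple_probability_box mA)).
- move=> _; have -> : setT = box (fun=> setT) :> set (n.-tuple E).
    by apply/seteqP; split.
  by rewrite mE// big1 ?ltry// => i _; rewrite probability_setT.
Qed.

Lemma ge0_integral_tuple_probability n (f : n.+1.-tuple E -> \bar R) :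
  measurable_fun setT f -> (forall t, 0 <= f t)%E ->
  (\int[tuple_probability n.+1]_t f t =
   \int[tuple_probability n]_t \int[nu]_x f (cons_pair (x, t)))%E.
Proof.
move=> mf f0; rewrite /= ge0_integral_distribution//.
rewrite /product_probability fubini_tonelli2//.
  exact: measurableT_comp.
by move=> xt; exact: f0.
Qed.

Definition bounded_differences n (F : n.-tuple E -> R) (c : R) :=
  forall (i : 'I_n) (t u : n.-tuple E),
    (forall j, j != i -> tnth t j = tnth u j) -> `|F t - F u| <= c.

(** Integrating out the first coordinate turns [F] into [G], which has the same mean and inherits
    bounded differences. For a fixed tail, [F - G] is centred in that coordinate and [F] oscillates
    by at most [c], so each coordinate costs one factor [expR ((s * c) ^+ 2)]. *)
Theorem mcdiarmid_exp_moment n (F : n.-tuple E -> R) (c s : R) :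
  measurable_fun setT F -> (forall t, 0 <= F t <= 1) ->
  bounded_differences F c -> `|s| * c <= 4^-1 ->
  (\int[tuple_probability n]_t
     (expR (s * (F t - \int[tuple_probability n]_u F u)))%:E
   <= (expR (n%:R * (s * c) ^+ 2))%:E)%E.
Proof.
elim: n F => [|n IH] F mF F01 Fc sc.
  rewrite mul0r expR0.
  have FE : F = cst (F [tuple]) by apply/funext => t; rewrite (tuple0 t).
  rewrite FE (Rintegral_probability_cst (tuple_probability 0)).
  rewrite (_ : (fun _ => _) = cst 1%E) ?integral_probability_cst//.
  by apply/funext => t; rewrite /= subrr mulr0 expR0.
pose G (t : n.-tuple E) := \int[nu]_x F (cons_pair (x, t)).
have mFc t : measurable_fun setT (fun x => F (cons_pair (x, t))).
  apply: measurableT_comp => //; rewrite /cons_pair/=.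
  exact: (measurable_cons (@measurable_id _ _ _) (measurable_cst t)).
have iFc t : nu.-integrable setT (EFin \o (fun x => F (cons_pair (x, t)))).
  apply: (@bounded_integrable _ _ _ _ _ 1) => // x.
  by have /andP[? ?] := F01 (cons_pair (x, t)); rewrite ger0_norm.
have mFE : measurable_fun setT (fun xt => (F (cons_pair xt))%:E).
  by apply/measurable_EFinP; exact: measurableT_comp.
have GE : EFin \o G = fubini_G nu (fun xt => (F (cons_pair xt))%:E).
  by apply/funext => t; rewrite /= EFin_Rintegral.
have mG : measurable_fun setT G.
  apply/measurable_EFinP; rewrite GE; apply: measurable_fun_fubini_tonelli_G => //.
  by move=> xt; rewrite lee_fin; have /andP[] := F01 (cons_pair xt).
have G01 t : 0 <= G t <= 1 by exact: Rintegral_bounds.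
have Gc : bounded_differences G c.
  move=> i t u tu; rewrite /G -RintegralB//.
  have : - c <= \int[nu]_x (F (cons_pair (x, t)) - F (cons_pair (x, u))) <= c.
    apply: Rintegral_bounds => [|x]; first exact: measurable_funB.
    rewrite -ler_norml; apply: (Fc (lift ord0 i)) => j.
    case: (unliftP ord0 j) => [k ->|->]; last by rewrite !tnth0.
    by rewrite (inj_eq lift_inj) !tnthS; exact: tu.
  by rewrite ler_norml.
have mean : \int[tuple_probability n.+1]_u F u = \int[tuple_probability n]_t G t.
  congr fine; rewrite ge0_integral_tuple_probability//; last 2 first.
  - exact/measurable_EFinP.
  - by move=> t; rewrite lee_fin; have /andP[] := F01 t.
  by apply: eq_integral => t _; rewrite -EFin_Rintegral.
rewrite mean ge0_integral_tuple_probability//; last first.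
  apply/measurable_EFinP; apply: measurableT_comp; first exact: measurable_expR.
  by apply: measurable_funM => //; exact: measurable_funB.
set m := Rintegral _ _ _.
apply: (@le_trans _ _ (\int[tuple_probability n]_t
    ((expR ((s * c) ^+ 2))%:E * (expR (s * (G t - m)))%:E))%E).
  apply: ge0_le_integral => //.
  - by move=> t _; apply: integral_ge0 => x _; rewrite lee_fin expR_ge0.
  - apply: (measurable_fun_fubini_tonelli_G
      (fun xt => (expR (s * (F (cons_pair xt) - m)))%:E)).
    + apply/measurable_EFinP; apply: measurableT_comp; first exact: measurable_expR.
      apply: measurable_funM => //; apply: measurable_funB => //.
      exact: measurableT_comp.
    + by move=> xt; rewrite lee_fin expR_ge0.
  - apply: emeasurable_funM => //; apply/measurable_EFinP.
    apply: measurableT_comp; first exact: measurable_expR.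
    by apply: measurable_funM => //; exact: measurable_funB.
  move=> t _; rewrite [leRHS]muleC.
  (* The exponent splits into [s * (G t - m)], constant in the first coordinate, and a centred
     part. *)
  have -> : (fun x => (expR (s * (F (cons_pair (x, t)) - m)))%:E) =
      (fun x => (expR (s * (G t - m)))%:E *
                (expR (s * (F (cons_pair (x, t)) - G t)))%:E)%E.
    apply/funext => x; rewrite -EFinM -expRD; congr (expR _)%:E; ring.
  rewrite ge0_integralZl//; last first.
    apply/measurable_EFinP; apply: measurableT_comp; first exact: measurable_expR.
    by apply: measurable_funM => //; exact: measurable_funB.
  rewrite lee_wpmul2l ?lee_fin ?expR_ge0//.
  apply: exp_moment_bounded_oscillation => // x y.
  by apply: (Fc ord0) => j; case: (unliftP ord0 j) => [k ->|->]; rewrite ?tnthS// eqxx.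
rewrite ge0_integralZl//; last first.
  apply/measurable_EFinP; apply: measurableT_comp; first exact: measurable_expR.
  by apply: measurable_funM => //; exact: measurable_funB.
rewrite -natr1 mulrDl mul1r addrC expRD EFinM lee_wpmul2l ?lee_fin ?expR_ge0//.
exact: IH.
Qed.

End tuple_measure.

(** * Concentration and almost sure convergence *)

Section concentration.
Context (R : realType).

Lemma exponential_markov d (T : measurableType d) (m : probability T R)
    (h : T -> R) (e M : R) : measurable_fun setT h ->
  (\int[m]_x (expR (h x))%:E <= M%:E)%E ->
  (m [set x | (e <= h x)%R] <= (expR (- e) * M)%:E)%E.
Proof.
move=> mh hM.
have mexp : measurable_fun setT (fun x => (expR (h x))%:E).
  by apply/measurable_EFinP; apply: measurableT_comp; first exact: measurable_expR.
have := le_integral_abse m measurableT mexp (expR_gt0 e).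
rewrite setTI => /le_trans => /(_ M%:E).
have -> : [set x | ((expR e)%:E <= `|(expR (h x))%:E|)%E] = [set x | e <= h x].
  by apply/seteqP; split => x /=; rewrite lee_fin ger0_norm ?expR_ge0// ler_expR.
have -> : (\int[m]_x `|(expR (h x))%:E| = \int[m]_x (expR (h x))%:E)%E.
  by apply: eq_integral => x _; rewrite /= ger0_norm ?expR_ge0.
move=> /(_ hM) le1.
have mfin : m [set x | e <= h x] \is a fin_num.
  by apply: fin_num_measure; apply: measurable_set_ler.
rewrite -(fineK mfin) lee_fin -(ler_pM2l (expR_gt0 e)) mulrA -expRD subrr expR0 mul1r.
by rewrite -lee_fin EFinM fineK.
Qed.

Lemma mcdiarmid d (E : measurableType d) (nu : probability E R) n
    (F : n.-tuple E -> R) (e : R) :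
  measurable_fun setT F -> (forall t, 0 <= F t <= 1) ->
  (0 < n)%N -> bounded_differences F (2 / n%:R) -> 0 < e <= 1 ->
  (tuple_probability nu n
     [set t | (e <= `|F t - \int[tuple_probability nu n]_u F u|)%R]
   <= (2 * expR (- (e ^+ 2 / 16)) ^+ n)%:E)%E.
Proof.
move=> mF F01 n0 Fc /andP[e0 e1]; set m := Rintegral _ _ _.
have n0R : 0 < n%:R :> R by rewrite ltr0n.
(* This [s] minimises [4 * s ^+ 2 / n%:R - s * e]. It gives [s * (2 / n%:R) = e / 4], which meets
   the smallness condition since [e <= 1]. *)
pose s := n%:R * e / 8.
have s0 : 0 < s by rewrite !mulr_gt0// invr_gt0.
have sE : `|s| * (2 / n%:R) = e / 4.
  by rewrite gtr0_norm// /s; field; rewrite gt_eqF.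
(* The sign [(-1) ^+ b] treats the upper and the lower tail together. *)
have tail (b : bool) : (tuple_probability nu n
     [set t | (s * e <= (-1) ^+ b * s * (F t - m))%R]
   <= (expR (- (e ^+ 2 / 16)) ^+ n)%:E)%E.
  have := @mcdiarmid_exp_moment _ _ _ nu n F (2 / n%:R) ((-1) ^+ b * s) mF F01 Fc.
  rewrite normrM normrX normrN1 expr1n mul1r sE => /(_ ltac:(lra)) /exponential_markov.
  move=> /(_ (s * e)) => /(_ _) /le_trans; apply.
    by apply: measurable_funM => //; exact: measurable_funB.
  rewrite lee_fin -expRD -expRM_natl ler_expR.
  have -> : ((-1) ^+ b * s * (2 / n%:R)) ^+ 2 = (e / 4) ^+ 2.
    by rewrite -sE gtr0_norm// !exprMn sqrr_sign mul1r.
  by rewrite /s le_eqVlt; apply/orP; left; apply/eqP; field.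
have mtail (b : bool) : measurable [set t | (s * e <= (-1) ^+ b * s * (F t - m))%R].
  apply: measurable_set_ler => //.
  by apply: measurable_funM => //; exact: measurable_funB.
apply: (@le_trans _ _ (tuple_probability nu n
    ([set t | (s * e <= (-1) ^+ false * s * (F t - m))%R] `|`
     [set t | (s * e <= (-1) ^+ true * s * (F t - m))%R]))).
  apply: le_measure; rewrite ?inE; last 1 first.
  - move=> t /=; rewrite expr0 expr1 !mul1r mulN1r mulNr -mulrN !ler_pM2l//.
    by rewrite ler_normr => /orP.
  - apply: measurable_set_ler => //.
    by apply: measurableT_comp => //; exact: measurable_funB.
  - exact: measurableU.
apply: le_trans (measureU2 _ _ _) _ => //.
by rewrite mulr2n mulrDl mul1r EFinD leeD//; exact: tail.
Qed.

Lemma independent_tuple_law d' (T : measurableType d') (P : probability T R)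
    d (E : measurableType d) (nu : probability E R) n
    (X : 'I_n -> {RV P >-> E}) :
  independent_family P X ->
  (forall i B, measurable B -> P (X i @^-1` B) = nu B) ->
  exists Z : {RV P >-> n.-tuple E},
    (forall w, Z w = [tuple X i w | i < n]) /\
    (forall B, measurable B -> distribution P Z B = tuple_probability nu n B).
Proof.
move=> ind law; pose Z (w : T) := [tuple X i w | i < n].
have mZ : measurable_fun setT Z.
  apply/measurable_fun_tnthP => i.
  rewrite (_ : _ \o _ = X i)//; apply/funext => w /=; exact: tnth_mktuple.
pose ZM := HB.pack Z (isMeasurableFun.Build _ _ _ _ Z mZ) : {mfun T >-> n.-tuple E}.
exists (ZM : {RV P >-> n.-tuple E}); split=> // B mB.
apply: (@tuple_probability_unique _ _ _ nu n (distribution P ZM)) => // A mA.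
transitivity (P (Z @^-1` box A)) => //.
have -> : Z @^-1` box A = \bigcap_(i in [set` [set: 'I_n]%SET]) (X i @^-1` A i).
  apply/seteqP; split => [w wA i _|w wA i].
    by have := wA i; rewrite /Z tnth_mktuple.
  by rewrite /Z tnth_mktuple; apply: wA; rewrite /= inE.
rewrite ind//; apply: eq_big => [i|i _]; first by rewrite inE.
exact: law.
Qed.

Lemma independent_mcdiarmid d' (T : measurableType d') (P : probability T R)
    d (E : measurableType d) (nu : probability E R) n
    (X : 'I_n -> {RV P >-> E}) (F : n.-tuple E -> R) (G : T -> R) (e : R) :
  independent_family P X ->
  (forall i B, measurable B -> P (X i @^-1` B) = nu B) ->
  (forall w, G w = F [tuple X i w | i < n]) ->
  measurable_fun setT F -> (forall t, 0 <= F t <= 1) ->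
  (0 < n)%N -> bounded_differences F (2 / n%:R) -> 0 < e <= 1 ->
  (P [set w | (e <= `|G w - \int[P]_v G v|)%R]
   <= (2 * expR (- (e ^+ 2 / 16)) ^+ n)%:E)%E.
Proof.
move=> ind law GE mF F01 n0 Fc e01.
have [Z [ZE Zlaw]] := independent_tuple_law ind law.
have mean : \int[tuple_probability nu n]_u F u = \int[P]_v G v.
  congr fine; rewrite (@eq_measure_integral _ _ _ _ (distribution P Z)); last first.
    by move=> A mA _; exact: esym (Zlaw A mA).
  rewrite ge0_integral_distribution//.
  - by apply: eq_integral => w _; rewrite /= ZE GE.
  - exact/measurable_EFinP.
  - by move=> t; rewrite lee_fin; have /andP[] := F01 t.
have := mcdiarmid nu mF F01 n0 Fc e01; rewrite mean => /(le_trans _); apply.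
rewrite -Zlaw; last first.
  apply: measurable_set_ler => //.
  by apply: measurableT_comp => //; exact: measurable_funB.
rewrite /distribution /pushforward le_eqVlt; apply/orP; left; apply/eqP.
by congr (P _); apply/seteqP; split => w /=; rewrite ZE GE.
Qed.

(** The convergent half of the Borel-Cantelli lemma, valid for any coupling of the [D n]. Running
    over the thresholds [e k] keeps the exceptional set a countable union. *)
Lemma ae_cvg0 d (T : measurableType d) (P : probability T R) (D : nat -> T -> R) :
  (forall n, measurable_fun setT (D n)) ->
  (forall e, 0 < e <= 1 -> exists2 q, 0 < q < 1 & forall n, (0 < n)%N ->
    (P [set w | (e <= `|D n w|)%R] <= (2 * q ^+ n)%:E)%E) ->
  {ae P, forall w, D n w @[n --> \oo] --> 0}.
Proof.
move=> mD tail.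
pose e (k : nat) : R := k.+1%:R^-1.
have e01 k : 0 < e k <= 1 by rewrite invr_gt0 ltr0Sn/= invf_le1 ?ltr0Sn// ler1n.
pose B k n := [set w | (e k <= `|D n w|)%R].
have mB k n : measurable (B k n).
  apply: measurable_set_ler => //.
  exact: measurableT_comp.
have negl k : P.-negligible (lim_sup_set (B k)).
  apply/negligibleP.
    by apply: bigcapT_measurable => n; apply: bigcup_measurable => j _; exact: mB.
  apply: lim_sup_set_cvg0 => //.
  have [q /andP[q0 q1] qP] := tail _ (e01 k).
  apply: (@le_lt_trans _ _ (2 / (1 - q))%:E); last exact: ltry.
  apply: lime_le; first exact: is_cvg_nneseries.
  apply: nearW => n.
  apply: (@le_trans _ _ (series (geometric 2 q) n)%:E); last first.
    by rewrite lee_fin geometric_le_lim// gtr0_norm.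
  rewrite /series/= -sumEFin; apply: lee_sum => -[_|i _]; last exact: qP.
  (* The tail bound is available for positive indices; at index 0 the geometric term is 2, above any
     probability. *)
  rewrite expr0 mulr1; apply: le_trans (probability_le1 _ _) _ => //.
  by rewrite lee_fin ler1n.
apply: negligibleS (negligible_bigcup negl) => w; apply: contra_notP => wB.
apply/cvgrPdist_lt => eps eps0.
have [k _ /(_ k (leqnn k)) ke] := near_infty_natSinv_lt (PosNum eps0).
have : ~ lim_sup_set (B k) w by move=> wk; apply: wB; exists k.
move=> /existsNP[n /not_implyP[_ nB]].
exists n => // j /= nj; rewrite sub0r normrN; apply: lt_trans ke.
by rewrite ltNge; apply/negP => ej; apply: nB; exists j.
Qed.

End concentration.

(** * Weak convergence from distribution functions *)

Section weak_convergence.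
Context (R : realType).
Local Notation realT := (measurableTypeR R).

Lemma uniform_continuity_segment (g : R -> R) (a b e : R) : continuous g -> 0 < e ->
  exists2 r, 0 < r &
    forall x y, a <= x <= b -> `|x - y| <= r -> `|g x - g y| <= e.
Proof.
move=> cg e0.
(* With radii [i.+1%:R^-1] the claim becomes one that holds for all large [i] locally in [x], and
   compactness then supplies one [i] for the whole segment. *)
pose P (i : nat) (x : R) := forall y, `|x - y| <= i.+1%:R^-1 -> `|g x - g y| <= e.
have /compact_near_coveringP /(_ nat \oo P _) := @segment_compact R a b.
case=> [x _|N _ NP].
  have e20 : 0 < e / 2 by rewrite divr_gt0.
  have /cvgrPdist_lt /(_ _ e20) := cg x.
  move=> /nbhs_ballP[/= r r0 rP].
  have r20 : 0 < r / 2 by rewrite divr_gt0.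
  have [N _ NP] := near_infty_natSinv_lt (PosNum r20).
  exists (ball x (r / 2), [set i | (N <= i)%N]).
    split; first exact: nbhsx_ballx.
    by exists N.
  move=> [x' i] [/= xx' Ni] y x'y.
  have := NP _ Ni => /= ir.
  have xy : ball x r y.
    rewrite /ball/=; move: xx'; rewrite /ball/= => xx'.
    apply: (le_lt_trans (ler_distD x' _ _)). have := le_lt_trans x'y ir; move: xx'; clear; lra.
  have xx : ball x r x' by move: xx'; rewrite /ball/=; lra.
  have := rP _ xy; have := rP _ xx => /=.
  by rewrite !ltr_norml ler_norml; lra.
exists N.+1%:R^-1; first by rewrite invr_gt0.
by move=> x y xab; apply: (NP N (leqnn N)); rewrite /= in_itv.
Qed.

Definition cdfR (m : set realT -> \bar R) (t : R) : R := fine (m `]-oo, t]%classic).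

Lemma cdfR_ge0 (m : probability realT R) t : 0 <= cdfR m t.
Proof. exact/fine_ge0/measure_ge0. Qed.

Lemma EFin_cdfR (m : probability realT R) t : (cdfR m t)%:E = m `]-oo, t]%classic.
Proof. by rewrite /cdfR fineK// fin_num_measure//; exact: measurable_itv. Qed.

Lemma cdfR_le1 (m : probability realT R) t : cdfR m t <= 1.
Proof. by rewrite -lee_fin EFin_cdfR probability_le1//; exact: measurable_itv. Qed.

Lemma cdfR_mono (m : probability realT R) s t : s <= t -> cdfR m s <= cdfR m t.
Proof.
move=> st; rewrite -lee_fin !EFin_cdfR le_measure// ?inE; try exact: measurable_itv.
by move=> x; rewrite /= !in_itv/= => /le_trans; apply.
Qed.

Definition ray (t x : R) : R := (x <= t)%R%:R.

Lemma measurable_ray t : measurable_fun [set: realT] (ray t).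
Proof.
rewrite (_ : ray t = \1_(`]-oo, t]%classic : set realT)); last first.
  apply/funext => x; rewrite /ray indicE; congr (nat_of_bool _)%:R.
  by apply/idP/idP; rewrite inE /= in_itv.
by apply: measurable_indic; exact: measurable_itv.
Qed.

Lemma integrable_ray (m : probability realT R) t : m.-integrable setT (EFin \o ray t).
Proof.
apply: (@bounded_integrable _ _ _ _ _ 1) => [|x]; first exact: measurable_ray.
by rewrite /ray; case: (x <= t); rewrite ?normr1 ?normr0.
Qed.

Lemma Rintegral_ray (m : probability realT R) t : \int[m]_x ray t x = cdfR m t.
Proof.
rewrite /cdfR -[X in m X]setIT -integral_indic//.
congr fine; apply: eq_integral => x _; congr EFin.
rewrite /ray indicE; congr (nat_of_bool _)%:R.
by apply/idP/idP; rewrite inE /= in_itv.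
Qed.

(** The step function equal to [g (s j.+1)] between [s j] and [s j.+1], to [g (s 1)] before the grid
    and to [g (s N)] after it. Written with rays, its integral involves values of the distribution
    function only. *)
Definition staircase (g : R -> R) (s : nat -> R) (N : nat) (x : R) : R :=
  g (s N) + \sum_(1 <= j < N) (g (s j) - g (s j.+1)) * ray (s j) x.

(** [ray (s 1) x + 1 - ray (s N) x] is the indicator of [x <= s 1] or [s N < x]. Outside the grid
    only the bound [M] is available, inside it the modulus [o]. *)
Lemma staircase_approx (g : R -> R) (s : nat -> R) N (o M : R) x :
  (0 < N)%N -> 0 <= o -> {homo s : i j / (i <= j)%N >-> i <= j} ->
  (forall x, `|g x| <= M) ->
  (forall j x, (0 < j < N)%N -> s j <= x <= s j.+1 -> `|g x - g (s j.+1)| <= o) ->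
  `|g x - staircase g s N x| <= o + 2 * M * (ray (s 1%N) x + 1 - ray (s N) x).
Proof.
move=> N0 o0 mono gM.
have M2 y z : `|g y - g z| <= 2 * M.
  by rewrite mulr_natl mulr2n (le_trans (ler_normB _ _))// lerD.
have M0 : 0 <= 2 * M := le_trans (normr_ge0 _) (M2 0 0).
elim: N N0 => // N IH _ gs; have [N0|N0] := posnP N.
  rewrite N0 /staircase big_geq// addr0 [ray _ x + 1]addrC addrK mulr1.
  by rewrite (le_trans (M2 _ _))// lerDr.
have {}IH : `|g x - staircase g s N x| <= o + 2 * M * (ray (s 1%N) x + 1 - ray (s N) x).
  by apply: IH => // j z /andP[j0 jN]; apply: gs; rewrite j0 ltnS ltnW.
have [xN|Nx] := leP x (s N).
  have xN1 : x <= s N.+1 by rewrite (le_trans xN)// mono.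
  rewrite {2}/ray xN1; move: IH; rewrite {2}/ray xN.
  rewrite /staircase big_nat_recr//= [ray (s N) x]/ray xN mulr1.
  by rewrite addrCA [g (s N) - _]addrC addNKr addrC.
have -> : staircase g s N.+1 x = g (s N.+1).
  rewrite /staircase big_nat_cond big1 ?addr0// => j /andP[/andP[_ jN] _].
  rewrite /ray leNgt (le_lt_trans _ Nx) ?mulr0// mono//.
have -> : ray (s 1%N) x = 0.
  by rewrite /ray leNgt (le_lt_trans _ Nx)// mono.
rewrite add0r /ray; case: (leP x (s N.+1)) => xN1.
  rewrite subrr mulr0 addr0; apply: gs; last by rewrite xN1 ltW.
  by rewrite N0 leqnn.
by rewrite subr0 mulr1 (le_trans (M2 _ _))// lerDr.
Qed.

Lemma integral_staircase (m : probability realT R) g s N :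
  m.-integrable setT (EFin \o staircase g s N) /\
  \int[m]_x staircase g s N x =
    g (s N) + \sum_(1 <= j < N) (g (s j) - g (s j.+1)) * cdfR m (s j).
Proof.
have ci c : m.-integrable setT (EFin \o cst c).
  by apply: (@bounded_integrable _ _ _ _ _ `|c|).
have zi c t : m.-integrable setT (EFin \o (fun x => c * ray t x)).
  apply: (@bounded_integrable _ _ _ _ _ `|c|) => [|x].
    by apply: measurable_funM => //; exact: measurable_ray.
  by rewrite normrM ler_piMr// /ray; case: (x <= t); rewrite ?normr1 ?normr0.
have sum_int (k : nat) : let S x := \sum_(1 <= j < k) (g (s j) - g (s j.+1)) * ray (s j) x in
    m.-integrable setT (EFin \o S) /\
    \int[m]_x S x = \sum_(1 <= j < k) (g (s j) - g (s j.+1)) * cdfR m (s j).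
  elim: k => [|k [IHi IH]] /=.
    rewrite big_geq//; have -> : (fun x => \sum_(1 <= j < 0) (g (s j) - g (s j.+1)) * ray (s j) x) = cst 0.
      by apply/funext => x; rewrite big_geq.
    by split; [exact: ci|rewrite Rintegral_probability_cst].
  have [k0|k0] := posnP k.
    rewrite k0 big_geq//; have -> : (fun x => \sum_(1 <= j < 1) (g (s j) - g (s j.+1)) * ray (s j) x) = cst 0.
      by apply/funext => x; rewrite big_geq.
    by split; [exact: ci|rewrite Rintegral_probability_cst].
  rewrite big_nat_recr//=.
  have -> : (fun x => \sum_(1 <= j < k.+1) (g (s j) - g (s j.+1)) * ray (s j) x) =
      (fun x => \sum_(1 <= j < k) (g (s j) - g (s j.+1)) * ray (s j) x +
        (g (s k) - g (s k.+1)) * ray (s k) x).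
    by apply/funext => x; rewrite big_nat_recr.
  split; first exact: (integrableD measurableT IHi (zi _ _)).
  rewrite RintegralD// IH RintegralZl//; first by rewrite Rintegral_ray.
  exact: integrable_ray.
have [Si SE] := sum_int N.
split; first exact: (integrableD measurableT (ci _) Si).
rewrite /staircase RintegralD//; last exact: ci.
by rewrite SE (Rintegral_probability_cst m).
Qed.

Lemma staircase_error (m : probability realT R) (g : R -> R) (s : nat -> R) N (o M : R) :
  continuous g -> (0 < N)%N -> 0 <= o -> {homo s : i j / (i <= j)%N >-> i <= j} ->
  (forall x, `|g x| <= M) ->
  (forall j x, (0 < j < N)%N -> s j <= x <= s j.+1 -> `|g x - g (s j.+1)| <= o) ->
  `|\int[m]_x g x - \int[m]_x staircase g s N x| <=
    o + 2 * M * (cdfR m (s 1%N) + 1 - cdfR m (s N)).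
Proof.
move=> cg N0 o0 mono gM gs.
have mg : measurable_fun [set: realT] g by exact: continuous_measurable_fun.
have gi : m.-integrable setT (EFin \o g) by exact: (bounded_integrable _ mg gM).
have [Si _] := integral_staircase m g s N.
have ci c : m.-integrable setT (EFin \o cst c).
  by apply: (@bounded_integrable _ _ _ _ _ `|c|).
have r1 : m.-integrable setT (EFin \o (fun x => ray (s 1%N) x + 1)).
  exact: (integrableD measurableT (integrable_ray m _) (ci 1)).
have r2 : m.-integrable setT (EFin \o (fun x => ray (s 1%N) x + 1 - ray (s N) x)).
  exact: (integrableB measurableT r1 (integrable_ray m _)).
have r3 : m.-integrable setT (EFin \o (fun x => 2 * M * (ray (s 1%N) x + 1 - ray (s N) x))).
  exact: (integrableZl measurableT _ r2).
have gsi : m.-integrable setT (EFin \o (fun x => g x - staircase g s N x)).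
  exact: (integrableB measurableT gi Si).
rewrite -RintegralB//.
apply: le_trans (le_normr_Rintegral measurableT gsi) _.
apply: (@le_trans _ _ (\int[m]_x (o + 2 * M * (ray (s 1%N) x + 1 - ray (s N) x)))).
  apply: le_Rintegral => //.
  - exact: integrable_norm.
  - exact: (integrableD measurableT (ci o) r3).
  by move=> x _; exact: staircase_approx.
rewrite RintegralD//; last exact: ci.
rewrite (Rintegral_probability_cst m) RintegralZl// RintegralB//; last exact: integrable_ray.
rewrite RintegralD//; [|exact: integrable_ray|exact: ci].
by rewrite !Rintegral_ray (Rintegral_probability_cst m).
Qed.

(* Abel summation on the grid [s]: each increment of [g] is at most [o], and
   [cdfR m (s j)] differs from [cdfR v (s j)] by at most two increments of [cdfR v],
   whose sum over the grid telescopes. *)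
Lemma weak_comparison (m v : probability realT R) (g : R -> R) (s : nat -> R)
    N (o M h t : R) :
  continuous g -> (0 < N)%N -> 0 <= o -> 0 <= M ->
  {homo s : i j / (i <= j)%N >-> i <= j} ->
  (forall x, `|g x| <= M) ->
  (forall j x, (0 < j < N)%N -> s j <= x <= s j.+1 -> `|g x - g (s j.+1)| <= o) ->
  (forall j, (j <= N)%N -> cdfR m (s j) <= cdfR v (s j.+1) + h) ->
  (forall j, (j <= N)%N -> cdfR v (s j) <= cdfR m (s j.+1) + h) ->
  cdfR v (s 2%N) <= t -> 1 - cdfR v (s N.-1) <= t -> 0 <= h ->
  `|\int[m]_x g x - \int[v]_x g x| <=
    4 * o + 8 * M * t + (4 * M + o * N%:R) * h.
Proof.
move=> cg N0 o0 M0 mono gM gs mv vm v2 vN h0.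
have em := staircase_error m cg N0 o0 mono gM gs.
have ev := staircase_error v cg N0 o0 mono gM gs.
have m1 := mv 1%N N0.
have mN : 1 - cdfR m (s N) <= t + h by have := vm N.-1 (leq_pred N); rewrite prednK//; lra.
have v1 : cdfR v (s 1%N) <= t by rewrite (le_trans _ v2)// cdfR_mono// mono.
have vN' : 1 - cdfR v (s N) <= t.
  by rewrite (le_trans _ vN)// lerB// cdfR_mono// mono// leq_pred.
have step j : (0 < j < N)%N ->
    `|cdfR m (s j) - cdfR v (s j)| <= cdfR v (s j.+1) - cdfR v (s j.-1) + h.
  move=> /andP[j0 jN]; have := mv j (ltnW jN).
  have := vm j.-1 (leq_trans (leq_pred j) (ltnW jN)); rewrite prednK//.
  have : cdfR v (s j) <= cdfR v (s j.+1) by rewrite cdfR_mono// mono.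
  have : cdfR v (s j.-1) <= cdfR v (s j) by rewrite cdfR_mono// mono// leq_pred.
  by rewrite ler_norml; lra.
have dist : `|\int[m]_x staircase g s N x - \int[v]_x staircase g s N x| <=
    o * (2 + N%:R * h).
  have [_ ->] := integral_staircase m g s N.
  have [_ ->] := integral_staircase v g s N.
  rewrite opprD addrACA subrr add0r -sumrB.
  apply: (@le_trans _ _ (\sum_(1 <= j < N) o * (cdfR v (s j.+1) - cdfR v (s j.-1) + h))).
    apply: le_trans (ler_norm_sum _ _ _) _; rewrite big_nat_cond [leRHS]big_nat_cond.
    apply: ler_sum => j /andP[jN _]; rewrite -mulrBr normrM ler_pM//; last exact: step.
    by apply: gs => //; rewrite lexx mono.
  rewrite -mulr_sumr ler_wpM2l// big_split/= sumr_const_nat.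
  apply: lerD; last first.
    by rewrite -[leLHS]mulr_natl ler_wpM2r// ler_nat leq_subr.
  have -> : \sum_(1 <= j < N) (cdfR v (s j.+1) - cdfR v (s j.-1)) =
      \sum_(1 <= j < N) ((cdfR v (s j.+1) + cdfR v (s j)) -
                         (cdfR v (s j) + cdfR v (s j.-1))).
    by apply: eq_bigr => j _; ring.
  rewrite (@telescope_sumr_eq _ 1 N (fun j => cdfR v (s j) + cdfR v (s j.-1)))//.
  have := cdfR_le1 v (s N); have := cdfR_le1 v (s N.-1).
  by have := cdfR_ge0 v (s 1%N); have := cdfR_ge0 v (s 0%N) => /=; lra.
have Mm : 2 * M * (cdfR m (s 1%N) + 1 - cdfR m (s N)) <= 2 * M * (2 * (t + h)).
  by rewrite ler_wpM2l ?mulr_ge0//; lra.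
have Mv : 2 * M * (cdfR v (s 1%N) + 1 - cdfR v (s N)) <= 2 * M * (2 * t).
  by rewrite ler_wpM2l ?mulr_ge0//; lra.
have -> : \int[m]_x g x - \int[v]_x g x =
  (\int[m]_x g x - \int[m]_x staircase g s N x) +
  (\int[m]_x staircase g s N x - \int[v]_x staircase g s N x) -
  (\int[v]_x g x - \int[v]_x staircase g s N x) by ring.
apply: le_trans (ler_normB _ _) _.
apply: le_trans (lerD (ler_normD _ _) (lexx _)) _.
have E1 : 2 * M * (2 * (t + h)) + 2 * M * (2 * t) + o * (2 + N%:R * h) + 2 * o =
  4 * o + 8 * M * t + (4 * M + o * N%:R) * h by ring.
by rewrite -E1; move: em ev dist Mm Mv; clear; lra.
Qed.

Lemma near_leq_nat (P : nat -> nat -> Prop) k :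
  (forall j, \forall n \near \oo, P j n) ->
  \forall n \near \oo, forall j, (j <= k)%N -> P j n.
Proof.
move=> Pn; elim: k => [|k IH].
  by near=> n => j; rewrite leqn0 => /eqP ->; near: n; exact: Pn.
near=> n => j; rewrite leq_eqVlt => /predU1P[->|jk].
  by near: n; exact: Pn.
by have := near IH n; apply.
Unshelve. all: by end_near. Qed.

(** A comparison up to a shift, in the manner of the Levy distance, is insensitive to atoms.
    Tightness of [m] follows from that of [v] by the same comparison. *)
Lemma asymptotically_weakly_equal_cdf (m v : nat -> probability realT R) :
  (forall t k e, 0 < k -> 0 < e ->
    \forall n \near \oo, cdfR (m n) t <= cdfR (v n) (t + k) + e) ->
  (forall t k e, 0 < k -> 0 < e ->
    \forall n \near \oo, cdfR (v n) t <= cdfR (m n) (t + k) + e) ->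
  (forall e, 0 < e -> exists K, \forall n \near \oo,
    cdfR (v n) (- K) <= e /\ 1 - cdfR (v n) K <= e) ->
  asymptotically_weakly_equal m v.
Proof.
move=> mv vm tight g cg [M0 gM0].
pose M := `|M0| + 1; have M1 : 0 < M by rewrite ltr_wpDl.
have gM x : `|g x| <= M by rewrite (le_trans (gM0 x))// (le_trans (ler_norm _))// lerDl.
have mg : measurable_fun [set: realT] g by exact: continuous_measurable_fun.
have gi (q : probability realT R) : q.-integrable setT (EFin \o g).
  exact: (bounded_integrable _ mg gM).
have -> : (fun n => \int[m n]_x (g x)%:E - \int[v n]_x (g x)%:E)%E =
    EFin \o (fun n => \int[m n]_x g x - \int[v n]_x g x).
  by apply/funext => n; rewrite /= EFinB !EFin_Rintegral.
apply: cvg_EFin; first exact: nearW.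
apply/cvgrPdist_le => e e0.
(* The bound of [weak_comparison] has three terms; [t], [o] and [h] are chosen to make each of them
   [e / 4]. *)
pose t := e / (32 * M); have t0 : 0 < t by rewrite divr_gt0// mulr_gt0.
have [K0 tK0] := tight _ t0.
pose K := `|K0| + 1; have K1 : 0 < K by rewrite ltr_wpDl.
have KK0 : K0 <= K by rewrite (le_trans (ler_norm _))// lerDl.
pose o := e / 16; have o0 : 0 < o by rewrite divr_gt0.
(* The margin 2 leaves room for two grid steps of length at most 1, so that [s 2] is below [- K] and
   [s N.-1] above [K]. *)
pose a := - K - 2; pose b := K + 2.
have ab : 0 < b - a by rewrite /a /b; lra.
have [r r0 gr] := uniform_continuity_segment a b cg o0.
pose r1 := Num.min r 1; have r10 : 0 < r1 by rewrite lt_min r0 ltr01.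
pose N := (Num.truncn ((b - a) / r1)).+1.
pose D := (b - a) / N%:R.
have N0 : 0 < N%:R :> R by rewrite ltr0n.
have D0 : 0 < D by rewrite divr_gt0.
have Dr1 : D <= r1.
  rewrite ler_pdivrMr// mulrC -ler_pdivrMr//; apply/ltW.
  by rewrite truncnS_gt//.
have Dr : D <= r by rewrite (le_trans Dr1)// ge_min lexx.
have D1 : D <= 1 by rewrite (le_trans Dr1)// ge_min lexx orbT.
pose s (j : nat) := a + j%:R * D.
have mono : {homo s : i j / (i <= j)%N >-> i <= j}.
  by move=> i j ij; rewrite lerD2l ler_wpM2r ?ler_nat// ltW.
have sS j : s j.+1 = s j + D by rewrite /s -natr1 mulrDl mul1r addrA.
have sN : s N = b by rewrite /s mulrC divfK ?gt_eqF//; lra.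
pose h := e / (4 * (4 * M + o * N%:R)).
have MN : 0 < 4 * M + o * N%:R by rewrite addr_gt0 ?mulr_gt0.
have h0 : 0 < h by rewrite divr_gt0// mulr_gt0.
(* The allowed shift is exactly the mesh [D], so a shifted grid point is the next grid point. *)
have mvN := near_leq_nat N (fun j => mv (s j) D h D0 h0).
have vmN := near_leq_nat N (fun j => vm (s j) D h D0 h0).
near=> n.
have mvn : forall j, (j <= N)%N -> cdfR (m n) (s j) <= cdfR (v n) (s j.+1) + h.
  by move=> j jN; rewrite sS; apply: (near mvN n).
have vmn : forall j, (j <= N)%N -> cdfR (v n) (s j) <= cdfR (m n) (s j.+1) + h.
  by move=> j jN; rewrite sS; apply: (near vmN n).
have [tl tr] : cdfR (v n) (- K0) <= t /\ 1 - cdfR (v n) K0 <= t by apply: (near tK0 n).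
rewrite sub0r normrN.
have := @weak_comparison (m n) (v n) g s N o M h t cg isT (ltW o0) (ltW M1) mono gM.
have gs j x : (0 < j < N)%N -> s j <= x <= s j.+1 -> `|g x - g (s j.+1)| <= o.
  move=> /andP[j0 jN] /andP[sx xs].
  have sja : a <= s j by rewrite lerDl mulr_ge0// ltW.
  have sjb : s j.+1 <= b by rewrite -sN mono.
  apply: gr; first by rewrite (le_trans sja sx) (le_trans xs sjb).
  by move: sx xs Dr; rewrite sS ler_norml; lra.
have v2 : cdfR (v n) (s 2%N) <= t.
  rewrite (le_trans _ tl)// cdfR_mono// !sS /s mul0r addr0 /a.
  by move: D1 KK0; clear; lra.
have vN : 1 - cdfR (v n) (s N.-1) <= t.
  rewrite (le_trans _ tr)// lerB// cdfR_mono//.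
  have : s N.-1 = b - D by rewrite -sN -[in RHS](prednK (ltn0Sn _ : (0 < N)%N)) sS addrK.
  by move=> ->; move: D1 KK0; rewrite /b; clear; lra.
move=> /(_ gs mvn vmn v2 vN (ltW h0)) /le_trans; apply.
have -> : (4 * M + o * N%:R) * h = e / 4 by rewrite /h; field; rewrite gt_eqF.
have -> : 8 * M * t = e / 4 by rewrite /t; field; rewrite gt_eqF.
rewrite /o.
by move: e0; clear; lra.
Unshelve. all: by end_near. Qed.

End weak_convergence.

(** * Taylor expansion with Peano remainder *)

Section taylor.
Context (R : realType).

Lemma mean_value_bound (h dh : R -> R) (a x C : R) :
  (forall t, `|t - a| <= `|x - a| -> is_derive t 1 h (dh t)) ->
  (forall t, `|t - a| <= `|x - a| -> `|dh t| <= C) ->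
  `|h x - h a| <= C * `|x - a|.
Proof.
move=> hd dC.
have cts (u v : R) : (forall t, u <= t <= v -> `|t - a| <= `|x - a|) ->
    {within `[u, v], continuous h}.
  move=> uv; apply: derivable_within_continuous => t; rewrite in_itv/= => /uv /hd.
  by case.
have [ax|xa|->] := ltgtP a x; last by rewrite !subrr normr0 mulr0.
- have xE : `|x - a| = x - a by rewrite gtr0_norm// subr_gt0.
  have sub t : a <= t <= x -> `|t - a| <= `|x - a|.
    by move=> /andP[at_ tx]; rewrite xE ger0_norm ?subr_ge0//; lra.
  have [t|t tI ->] := @MVT R h dh a x ax _ (cts _ _ sub).
    by rewrite in_itv/= => /andP[? ?]; apply: hd; apply: sub; rewrite !ltW.
  rewrite normrM ler_wpM2r// dC// sub//.
  by move: tI; rewrite in_itv/= => /andP[? ?]; rewrite !ltW.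
- have xE : `|x - a| = a - x by rewrite distrC gtr0_norm// subr_gt0.
  have sub t : x <= t <= a -> `|t - a| <= `|x - a|.
    by move=> /andP[at_ tx]; rewrite xE distrC ger0_norm ?subr_ge0//; lra.
  have [t|t tI hE] := @MVT R h dh x a xa _ (cts _ _ sub).
    by rewrite in_itv/= => /andP[? ?]; apply: hd; apply: sub; rewrite !ltW.
  rewrite distrC hE normrM [X in _ * X]distrC ler_wpM2r// dC// sub//.
  by move: tI; rewrite in_itv/= => /andP[? ?]; rewrite !ltW.
Qed.

Lemma is_derive_horner_shift (p : {poly R}) (a t : R) :
  is_derive t 1 (fun x => p.[x - a]) (p^`()%R).[t - a].
Proof.
have -> : (fun x => p.[x - a]) = horner (p \Po ('X - a%:P)).
  by apply/funext => x; rewrite horner_comp !hornerE.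
apply: DeriveDef; first exact: derivable_horner.
by rewrite -derive1E -derivE deriv_comp derivXsubC mulr1 horner_comp !hornerE.
Qed.

Definition primitive_poly (c : R) (q : {poly R}) : {poly R} :=
  \poly_(i < (size q).+1) (if i is j.+1 then q`_j / j.+1%:R else c).

Lemma coef0_primitive_poly c q : (primitive_poly c q)`_0 = c.
Proof. by rewrite coef_poly. Qed.

Lemma deriv_primitive_poly c q : (primitive_poly c q)^`()%R = q.
Proof.
apply/polyP => i; rewrite coef_deriv coef_poly ltnS.
case: ltnP => [_|si]; last by rewrite mul0rn nth_default.
by rewrite -[_ *+ _]mulr_natr divfK.
Qed.

(** Induction through [derive1 f]: its polynomial is integrated from the value [f a], and the mean
    value inequality raises the order of the remainder by one. The base case is the definition of
    the derivative, so the top order is used at [a] only. *)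
Lemma taylor_peano l (f : R -> R) (a : R) : (0 < l)%N ->
  times_differentiable_at l f a ->
  exists P : {poly R}, [/\ P`_0 = f a, P`_1 = derive1 f a &
    forall e, 0 < e -> exists2 r, 0 < r &
      forall x, `|x - a| <= r -> `|f x - P.[x - a]| <= e * `|x - a| ^+ l].
Proof.
case: l => // l _; elim: l f => [|l IH] f [fnear fa].
  exists (primitive_poly (f a) (derive1 f a)%:P); split.
  - by rewrite coef0_primitive_poly.
  - have := congr1 (fun q : {poly R} => q`_0) (deriv_primitive_poly (f a) (derive1 f a)%:P).
    by rewrite /= coef_deriv mulr1n coefC eqxx.
  move=> e e0.
  have D : (fun h : R => h^-1 *: (f (h *: 1 + a) - f a)) @ 0^' --> derive1 f a.
    by rewrite derive1E; exact: fa.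
  have /cvgrPdist_le /(_ _ e0) := D.
  rewrite near_withinE => /nbhs_ballP[r /= r0 rP].
  exists (r / 2); first by rewrite divr_gt0.
  move=> x xr.
  have PE : (primitive_poly (f a) (derive1 f a)%:P).[x - a] = f a + derive1 f a * (x - a).
    rewrite horner_poly size_polyC; case: eqVneq => [->|d0] /=.
      by rewrite big_ord_recl big_ord0 expr0 mulr1 addr0 mul0r addr0.
    by rewrite !big_ord_recl big_ord0 expr0 !mulr1 addr0 /= addn0 polyseqC d0 /= divr1.
  rewrite PE expr1.
  have [->|xa] := eqVneq x a; first by rewrite subrr mulr0 addr0 subrr normr0 mulr0.
  have xa0 : x - a != 0 by rewrite subr_eq0.
  have := rP (x - a); rewrite /ball/= sub0r normrN => /(_ _ xa0).
  have -> : `|x - a| < r by lra.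
  move=> /(_ isT); rewrite -(ler_pM2r (_ : 0 < `|x - a|)) ?normr_gt0// => h.
  apply: le_trans h; rewrite -normrM -[leLHS]normrN le_eqVlt; apply/orP; left; apply/eqP; congr `| _ |.
  by rewrite /GRing.scale/= mulr1 subrK; field.
have fa' : times_differentiable_at l.+1 (derive1 f) a.
  split => [j jl|]; last by rewrite -[l.+1.-1]/l -derive1Sn.
  by have := fnear j.+1; rewrite ltnS => /(_ jl); rewrite derive1Sn.
have [Q [Q0 Q1 QP]] := IH _ fa'.
exists (primitive_poly (f a) Q); split.
- by rewrite coef0_primitive_poly.
- have := congr1 (fun q : {poly R} => q`_0) (deriv_primitive_poly (f a) Q).
  by rewrite /= coef_deriv mulr1n => ->.
move=> e e0; have [r r0 rQ] := QP e e0.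
have /nbhs_ballP[s /= s0 sP] := fnear 0%N isT.
exists (Num.min r (s / 2)); first by rewrite lt_min r0 divr_gt0.
move=> x; rewrite le_min => /andP[xr xs].
pose P := primitive_poly (f a) Q.
have -> : f x - P.[x - a] = (f x - P.[x - a]) - (f a - P.[a - a]).
  by rewrite subrr horner_coef0 coef0_primitive_poly subrr subr0.
rewrite exprSr mulrA.
apply: (@mean_value_bound (fun x => f x - P.[x - a]) (fun t => derive1 f t - Q.[t - a])).
  move=> t tx; apply: is_deriveB.
    by rewrite derive1E; apply: derivableP; apply: sP; rewrite /ball/= distrC; lra.
  by rewrite -{1}(deriv_primitive_poly (f a) Q); exact: is_derive_horner_shift.
move=> t tx; apply: le_trans (rQ t _) _; first by rewrite (le_trans tx).
rewrite ler_wpM2l ?(ltW e0)// lerXn2r ?nnegrE//.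
Qed.

(** The slope is taken at 0 rather than at [u]: by continuity of the derivative at 0 it serves for
    all small [u] at once. This is what gives the Gram matrix one constant coefficient. *)
Lemma horner_linearization (P : {poly R}) (e : R) : 0 < e ->
  exists2 r, 0 < r & forall u v, `|u| <= r -> `|v| <= r ->
    `|P.[u + v] - P.[u] - P`_1 * v| <= e * `|v|.
Proof.
move=> e0; pose D := P^`()%R.
have D0 : D.[0] = P`_1 by rewrite horner_coef0 coef_deriv mulr1n.
have cD : {for 0, continuous (horner D)}.
  exact/differentiable_continuous/derivable1_diffP/derivable_horner.
have /cvgrPdist_le /(_ _ e0) /nbhs_ballP[r /= r0 rP] := cD.
exists (r / 4); first by rewrite divr_gt0.
move=> u v ur vr.
pose h t := P.[t - 0] - P`_1 * t.
have -> : P.[u + v] - P.[u] - P`_1 * v = h (u + v) - h u by rewrite /h !subr0; ring.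
have vE : v = (u + v) - u by ring.
rewrite {2}vE.
apply: (@mean_value_bound h (fun t => D.[t - 0] - P`_1)) => t tu.
  apply: is_deriveB; first exact: is_derive_horner_shift.
  by apply: is_derive_eq; rewrite /GRing.scale/= mulr1.
rewrite -D0 subr0 distrC; apply: rP; rewrite /ball/= sub0r normrN.
have := ler_distD u t 0; rewrite !subr0 => h1; move: tu; rewrite -vE => tu; lra.
Qed.

(** Taylor's formula for polynomials separates the variables: [P.[a i + a j]] is the sum over [k] of
    [a i ^+ k] times the normalised [k]-th derivative of [P] at [a j]. *)
Lemma rank_horner_add n (P : {poly R}) (a : 'I_n -> R) :
  (\rank (\matrix_(i < n, j < n) P.[a i + a j]) <= size P)%N.
Proof.
pose U : 'M[R]_(n, size P) := \matrix_(i, k) a i ^+ k.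
pose V : 'M[R]_(size P, n) := \matrix_(k, j) (P^`N(k)).[a j].
have -> : \matrix_(i < n, j < n) P.[a i + a j] = U *m V.
  apply/matrixP => i j; rewrite !mxE addrC nderiv_taylor; last exact: mulrC.
  by apply: eq_bigr => k _; rewrite !mxE mulrC.
by rewrite (leq_trans (mxrankM_maxl _ _))// rank_leq_col.
Qed.

End taylor.

(** * Decomposition of the kernel matrix *)

Section kernel_decomposition.
Context (R : realType).

Definition inner p (x y : 'cV[R]_p) : R := \sum_k x k ord0 * y k ord0.

Lemma enorm_sqr p (x : 'cV[R]_p) : enorm x ^+ 2 = inner x x.
Proof.
rewrite sqr_sqrtr; first by apply: eq_bigr => k _; rewrite expr2.
by apply: sumr_ge0 => k _; exact: sqr_ge0.
Qed.

Lemma enorm_ge0 p (x : 'cV[R]_p) : 0 <= enorm x.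
Proof. exact: sqrtr_ge0. Qed.

Lemma innerC p (x y : 'cV[R]_p) : inner x y = inner y x.
Proof. by apply: eq_bigr => k _; rewrite mulrC. Qed.

Lemma enorm_sub_sqr p (x y : 'cV[R]_p) :
  enorm (x - y) ^+ 2 = enorm x ^+ 2 + enorm y ^+ 2 - 2 * inner x y.
Proof.
rewrite !enorm_sqr /inner mulr_sumr -big_split/= -sumrB.
by apply: eq_bigr => k _; rewrite !mxE; ring.
Qed.

Lemma sqr_add_le (u v : R) : (u + v) ^+ 2 <= 2 * u ^+ 2 + 2 * v ^+ 2.
Proof. by have := sqr_ge0 (u - v); rewrite sqrrB sqrrD; lra. Qed.

Section fixed_vectors.
Context (f : R -> R) (l n p : nat) (x : 'I_n -> 'cV[R]_p).

Definition kernel_mx : 'M[R]_n := \matrix_(i, j) f (enorm (x i - x j) ^+ 2).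

Definition gram_mx : 'M[R]_n := \matrix_(i, j) inner (x i) (x j).

(** The scalar term repairs the diagonal: with a_i the deviation of the squared norm from 1, the
    entry is [f 0 - (f 2 + 2 * derive1 f 2 * a_i)], which is [f 0] minus the linear part of the
    Taylor polynomial at [2 * a_i]. *)
Definition linear_mx : 'M[R]_n :=
  (f 0 - f 2 + 2 * derive1 f 2)%:M + (- (2 * derive1 f 2)) *: gram_mx.

Lemma kernel_mx_sym : kernel_mx^T = kernel_mx.
Proof.
apply/matrixP => i j; rewrite !mxE !enorm_sub_sqr innerC; congr (f _); ring.
Qed.

Lemma gram_mx_sym : gram_mx^T = gram_mx.
Proof. by apply/matrixP => i j; rewrite !mxE innerC. Qed.

Lemma linear_mx_sym : linear_mx^T = linear_mx.
Proof. by rewrite /linear_mx linearD/= tr_scalar_mx linearZ/= gram_mx_sym. Qed.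

Definition norm_dev (i : 'I_n) : R := `|enorm (x i) - 1| ^+ (2 * l).

(** The random quantity controlling all off-diagonal errors; its mean is O(n). Diagonal pairs are
    left out because [inner (x i) (x i)] is near 1. *)
Definition total_dev : R :=
  \sum_i \sum_(j | j != i) (norm_dev i + norm_dev j + inner (x i) (x j) ^+ 2).

Definition near_simplex (e : R) :=
  (forall i, `|enorm (x i) ^+ 2 - 1| <= e) /\
  (forall i j, i != j -> `|enorm (x i - x j) ^+ 2 - 2| <= e).

Lemma norm_dev_ge0 i : 0 <= norm_dev i.
Proof. exact: exprn_ge0. Qed.

Lemma sqnorm_le (M : 'M[R]_n) (k : R) : 0 <= k ->
  (forall i, M i i ^+ 2 <= k) ->
  (forall i j, i != j ->
    M i j ^+ 2 <= k * (norm_dev i + norm_dev j + inner (x i) (x j) ^+ 2)) ->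
  sqnorm M <= k * (n%:R + total_dev).
Proof.
move=> k0 Mii Mij.
rewrite /sqnorm mulrDr /total_dev mulr_sumr.
have -> : k * n%:R = \sum_(i < n) k by rewrite sumr_const card_ord mulr_natr.
rewrite -big_split/=; apply: ler_sum => i _; rewrite (bigD1 i)//= lerD//.
by rewrite mulr_sumr; apply: ler_sum => j ji; apply: Mij; rewrite eq_sym.
Qed.

Lemma near_simplex_inner e i j : near_simplex e -> i != j ->
  `|2 * inner (x i) (x j)| <= 3 * e.
Proof.
move=> [xe xxe] ij; have := xxe i j ij; rewrite enorm_sub_sqr.
have := xe i; have := xe j; rewrite !ler_norml; lra.
Qed.

Lemma near_simplex_gram e i : e <= 1 -> near_simplex e -> `|inner (x i) (x i)| <= 2.
Proof.
by move=> e1 [/(_ i) + _]; rewrite enorm_sqr !ler_norml; lra.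
Qed.

(** The moment hypothesis concerns the norm, the expansion its square. The factor [enorm (x i) + 1]
    between the two deviations is at most 3, hence [9 ^+ l]. *)
Lemma near_simplex_norm_dev e i : e <= 1 -> near_simplex e ->
  (enorm (x i) ^+ 2 - 1) ^+ (2 * l) <= 9 ^+ l * norm_dev i.
Proof.
move=> e1 [/(_ i) xe _].
have -> : enorm (x i) ^+ 2 - 1 = (enorm (x i) + 1) * (enorm (x i) - 1) by ring.
have x2 : enorm (x i) <= 2.
  rewrite -(@ler_pXn2r _ 2)// ?nnegrE ?enorm_ge0//.
  by move: xe; rewrite ler_norml; lra.
rewrite exprMn /norm_dev [`|_| ^+ _]exprM real_normK ?num_real// -exprM.
rewrite ler_wpM2r//; first by rewrite exprM exprn_ge0// sqr_ge0.
rewrite exprM lerXn2r ?nnegrE ?sqr_ge0//.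
have -> : 9 = 3 ^+ 2 :> R by ring.
by rewrite lerXn2r ?nnegrE//; have := enorm_ge0 (x i); lra.
Qed.

Lemma sqnorm_linear_mx e : e <= 4^-1 -> near_simplex e ->
  sqnorm linear_mx <=
    (2 * (f 0 - f 2 + 2 * derive1 f 2) ^+ 2 + 32 * (derive1 f 2) ^+ 2) *
    (n%:R + total_dev).
Proof.
move=> e1 xe; set al := f 0 - _ + _; set c := derive1 f 2.
have al2 := sqr_ge0 al; have c2 := sqr_ge0 c.
have e1' : e <= 1 by lra.
apply: sqnorm_le => [|i|i j ij].
- by lra.
- rewrite !mxE eqxx mulr1n; apply: le_trans (sqr_add_le _ _) _; rewrite lerD2l.
  have := near_simplex_gram i e1' xe; rewrite -(ler_pXn2r (_ : (0 < 2)%N))// ?nnegrE//.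
  rewrite real_normK ?num_real// => h; rewrite -/al -/c exprMn sqrrN exprMn.
  by have := ler_wpM2l c2 h; lra.
- rewrite !mxE (negbTE ij) mulr0n add0r -/c exprMn sqrrN exprMn.
  have := norm_dev_ge0 i; have := norm_dev_ge0 j => ui uj.
  have b2 := sqr_ge0 (inner (x i) (x j)).
  apply: (@le_trans _ _ ((2 * al ^+ 2 + 32 * c ^+ 2) * inner (x i) (x j) ^+ 2)).
    by rewrite ler_wpM2r//; lra.
  by rewrite ler_wpM2l//; lra.
Qed.

End fixed_vectors.

(** The sum is at most three times the largest absolute value, and [3 ^+ (2 * k) = 9 ^+ k]. *)
Lemma exprn_add3_le (a b c : R) k :
  (a + b + c) ^+ (2 * k) <= 9 ^+ k * (a ^+ (2 * k) + b ^+ (2 * k) + c ^+ (2 * k)).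
Proof.
have ge0 (u : R) : 0 <= u ^+ (2 * k) by rewrite exprM exprn_ge0// sqr_ge0.
have normE (u : R) : u ^+ (2 * k) = `|u| ^+ (2 * k).
  by rewrite !exprM real_normK ?num_real.
have bound (m : R) : `|a| <= m -> `|b| <= m -> `|c| <= m ->
    (a + b + c) ^+ (2 * k) <= 9 ^+ k * m ^+ (2 * k).
  move=> am bm cm; have m0 : 0 <= m := le_trans (normr_ge0 a) am.
  rewrite normE.
  have -> : 9 ^+ k * m ^+ (2 * k) = (3 * m) ^+ (2 * k).
    by rewrite exprMn [3 ^+ _]exprM; congr (_ ^+ _ * _); ring.
  rewrite lerXn2r ?nnegrE ?mulr_ge0//.
  apply: le_trans (ler_normD _ _) _; apply: le_trans (lerD (ler_normD _ _) cm) _; lra.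
have [ab|ba] := leP `|a| `|b|.
  have [bc|cb] := leP `|b| `|c|.
    apply: le_trans (bound `|c| (le_trans ab bc) bc (lexx _)) _.
    by rewrite ler_wpM2l ?exprn_ge0// -normE lerDr addr_ge0.
  apply: le_trans (bound `|b| ab (lexx _) (ltW cb)) _.
  by rewrite ler_wpM2l ?exprn_ge0// -normE addrAC lerDr addr_ge0.
have [ac|ca] := leP `|a| `|c|.
  apply: le_trans (bound `|c| ac (le_trans (ltW ba) ac) (lexx _)) _.
  by rewrite ler_wpM2l ?exprn_ge0// -normE lerDr addr_ge0.
apply: le_trans (bound `|a| (lexx _) (ltW ba) (ltW ca)) _.
by rewrite ler_wpM2l ?exprn_ge0// -normE -addrA lerDl addr_ge0.
Qed.

(** The order of the quantifiers is the point: the rank bound [s] depends only on the Taylor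
    polynomial, while [eta] may be taken arbitrarily small afterwards, uniformly in [n], [p] and the
    vectors. *)
Lemma kernel_decomposition (f : R -> R) l : (0 < l)%N ->
  times_differentiable_at l f 2 ->
  exists s : nat, forall eta, 0 < eta -> exists2 e, 0 < e <= 4^-1 &
    forall n p (x : 'I_n -> 'cV[R]_p), near_simplex x e ->
    exists L : 'M[R]_n, [/\ L^T = L, (\rank L <= s)%N &
      sqnorm (kernel_mx f x - linear_mx f x - L) <=
        eta * (n%:R + total_dev l x)].
Proof.
move=> l0 hf; have [P [P0 P1 PT]] := taylor_peano l0 hf.
exists (size P) => eta eta0.
(* Each factor [9 ^+ l] of [81 ^+ l] has its source: the power of a sum of three terms, and the
   passage from squared norm to norm. The 16 covers the coefficient [8 * 9 ^+ l + 8] of the squared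
   inner product. *)
pose C : R := 16 * 81 ^+ l.
have C1 : 1 <= 81 ^+ l :> R by rewrite exprn_ege1//; lra.
have C0 : 0 < C by rewrite /C; lra.
pose dl := Num.min 1 (eta / C).
have dl0 : 0 < dl by rewrite lt_min ltr01 divr_gt0.
have dl1 : dl <= 1 by rewrite ge_min lexx.
have dlC : dl ^+ 2 * C <= eta.
  have h : dl <= eta / C by rewrite ge_min lexx orbT.
  rewrite -ler_pdivlMr//; apply: le_trans h.
  by rewrite expr2 ler_piMl// ltW.
have [r1 r10 PT1] := PT _ dl0.
have [r2 r20 PL] := horner_linearization P dl0.
pose e := Num.min r1 (Num.min (r2 / 3) 4^-1).
have e0 : 0 < e by rewrite !lt_min r10 divr_gt0//= invr_gt0.
have er1 : e <= r1 by rewrite ge_min lexx.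
have er2 : e <= r2 / 3 by rewrite !ge_min lexx orbT.
have e4 : e <= 4^-1 by rewrite !ge_min lexx !orbT.
exists e; first by rewrite e0.
move=> n p x xe; have [xa xr] := xe.
pose a i := enorm (x i) ^+ 2 - 1.
have e1 : e <= 1 by lra.
exists (\matrix_(i, j) P.[a i + a j]); split.
- by apply/matrixP => i j; rewrite !mxE addrC.
- exact: rank_horner_add.
apply: (@le_trans _ _ ((dl ^+ 2 * C) * (n%:R + total_dev l x))); last first.
  rewrite ler_wpM2r// addr_ge0// sumr_ge0// => i _; rewrite sumr_ge0// => j _.
  by rewrite !addr_ge0 ?norm_dev_ge0 ?sqr_ge0.
have dl2 : 0 <= dl ^+ 2 by exact: sqr_ge0.
set c := derive1 f 2 in P1 *.
apply: sqnorm_le => [|i|i j ij]; first by rewrite mulr_ge0// ltW.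
- have ai : `|a i| <= e := xa i.
  (* On the diagonal everything cancels except the linearisation error of [P] at [u = 0],
     [v = 2 * a i]. *)
  have -> : (kernel_mx f x - linear_mx f x - \matrix_(i, j) P.[a i + a j]) i i =
      - (P.[0 + 2 * a i] - P.[0] - P`_1 * (2 * a i)).
    rewrite !mxE eqxx mulr1n subrr enorm_sqr.
    have -> : inner (0 : 'cV[R]_p) 0 = 0.
      by rewrite /inner big1// => k _; rewrite mxE mul0r.
    rewrite P1 horner_coef0 P0 add0r -/c.
    have -> : inner (x i) (x i) = a i + 1 by rewrite -enorm_sqr /a subrK.
    have -> : a i + a i = 2 * a i by ring.
    ring.
  rewrite sqrrN -real_normK ?num_real//.
  have h : `|P.[0 + 2 * a i] - P.[0] - P`_1 * (2 * a i)| <= dl * `|2 * a i|.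
    by apply: PL; rewrite ?normr0 ?ltW// normrM ger0_norm//; lra.
  have h1 : `|2 * a i| <= 1 by rewrite normrM ger0_norm//; lra.
  apply: (@le_trans _ _ (dl ^+ 2)).
    rewrite lerXn2r ?nnegrE// ?(ltW dl0)//; apply: le_trans h _.
    by rewrite ler_piMr// ltW.
  by rewrite ler_peMr// /C; lra.
- pose b := inner (x i) (x j); pose r := enorm (x i - x j) ^+ 2 - 2.
  have ai : `|a i| <= e := xa i.
  have aj : `|a j| <= e := xa j.
  have re : `|r| <= e := xr i j ij.
  have b3 : `|2 * b| <= 3 * e := near_simplex_inner xe ij.
  have rE : r = a i + a j + - (2 * b).
    by rewrite /r enorm_sub_sqr /a -/b; ring.
  have r2E : enorm (x i - x j) ^+ 2 = 2 + r by rewrite /r; ring.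
  (* Off the diagonal two errors remain: the Taylor remainder at [r], and the linearisation of [P]
     in the inner product around [a i + a j]. *)
  have -> : (kernel_mx f x - linear_mx f x - \matrix_(i, j) P.[a i + a j]) i j =
      (f (2 + r) - P.[r]) +
      (P.[a i + a j + - (2 * b)] - P.[a i + a j] - P`_1 * (- (2 * b))).
    by rewrite !mxE (negbTE ij) mulr0n r2E P1 -rE -/b -/c; ring.
  have h1 : `|f (2 + r) - P.[r]| <= dl * `|r| ^+ l.
    have := PT1 (2 + r); rewrite [2 + r - 2](_ : _ = r); last by ring.
    by apply; apply: le_trans er1.
  have h2 : `|P.[a i + a j + - (2 * b)] - P.[a i + a j] - P`_1 * (- (2 * b))| <=
      dl * `|2 * b|.
    rewrite -[`|2 * b|]normrN; apply: PL; last by rewrite normrN; lra.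
    by apply: le_trans (ler_normD _ _) _; lra.
  set T1 := f _ - _ in h1 *; set T2 := _ - _ * _ in h2 *.
  have T1sq : T1 ^+ 2 <= dl ^+ 2 * r ^+ (2 * l).
    rewrite -[T1 ^+ 2]real_normK ?num_real//.
    have -> : dl ^+ 2 * r ^+ (2 * l) = (dl * `|r| ^+ l) ^+ 2.
      by rewrite exprMn -exprM [(l * 2)%N]mulnC !exprM real_normK ?num_real.
    by rewrite lerXn2r ?nnegrE// mulr_ge0// ?exprn_ge0// ltW.
  have T2sq : T2 ^+ 2 <= dl ^+ 2 * (4 * b ^+ 2).
    rewrite -[T2 ^+ 2]real_normK ?num_real//.
    have -> : dl ^+ 2 * (4 * b ^+ 2) = (dl * `|2 * b|) ^+ 2.
      by rewrite exprMn real_normK ?num_real// exprMn; congr (_ * (_ * _)); ring.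
    by rewrite lerXn2r ?nnegrE// mulr_ge0// ltW.
  have := sqr_add_le T1 T2 => sq2.
  have ui := near_simplex_norm_dev l i e1 xe.
  have uj := near_simplex_norm_dev l j e1 xe.
  have ui0 := norm_dev_ge0 l x i; have uj0 := norm_dev_ge0 l x j.
  set u := norm_dev l x i in ui ui0 *; set v := norm_dev l x j in uj uj0 *.
  have b2 : 0 <= b ^+ 2 := sqr_ge0 b.
  (* [e <= 4^-1] makes [2 * b] at most 3/4 in absolute value, so its power [2 * l] is at most its
     square. *)
  have b2l : (- (2 * b)) ^+ (2 * l) <= 4 * b ^+ 2.
    rewrite exprM sqrrN -[(2 * b) ^+ 2]real_normK ?num_real// -exprM.
    have -> : 4 * b ^+ 2 = `|2 * b| ^+ 2.
      by rewrite real_normK ?num_real// exprMn; congr (_ * _); ring.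
    by rewrite ler_wiXn2l//; [lra|rewrite leq_pmulr].
  have rl : r ^+ (2 * l) <= 9 ^+ l * (9 ^+ l * u + 9 ^+ l * v + 4 * b ^+ 2).
    rewrite rE; apply: le_trans (exprn_add3_le _ _ _ _) _.
    by rewrite ler_wpM2l ?exprn_ge0// !lerD.
  have nn : 9 ^+ l * 9 ^+ l = 81 ^+ l :> R.
    by rewrite -exprMn; congr (_ ^+ _); ring.
  have n1 : 1 <= 9 ^+ l :> R by rewrite exprn_ege1//; lra.
  have n2 : 9 ^+ l <= 81 ^+ l :> R by rewrite lerXn2r ?nnegrE//; lra.
  have rl' : 2 * r ^+ (2 * l) + 8 * b ^+ 2 <= C * (u + v + b ^+ 2).
    apply: (@le_trans _ _ (2 * (81 ^+ l * u + 81 ^+ l * v + 9 ^+ l * (4 * b ^+ 2)) + 8 * b ^+ 2)).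
      by move: rl; rewrite !mulrDr !mulrA nn; lra.
    have k1 : 9 ^+ l * b ^+ 2 <= 81 ^+ l * b ^+ 2 by rewrite ler_wpM2r.
    have k2 : b ^+ 2 <= 81 ^+ l * b ^+ 2 by rewrite ler_peMl.
    have k3 : 0 <= 81 ^+ l * u by rewrite mulr_ge0// (le_trans _ C1).
    have k4 : 0 <= 81 ^+ l * v by rewrite mulr_ge0// (le_trans _ C1).
    rewrite /C; have -> : 9 ^+ l * (4 * b ^+ 2) = 4 * (9 ^+ l * b ^+ 2) by ring.
    have -> : 16 * 81 ^+ l * (u + v + b ^+ 2) =
      16 * (81 ^+ l * u) + 16 * (81 ^+ l * v) + 16 * (81 ^+ l * b ^+ 2) by ring.
    by move: k1 k2 k3 k4; clear; lra.
  apply: le_trans sq2 _.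
  apply: (@le_trans _ _ (dl ^+ 2 * (2 * r ^+ (2 * l) + 8 * b ^+ 2))).
    by move: T1sq T2sq; clear; lra.
  by rewrite -[leRHS]mulrA ler_wpM2l.
Qed.

End kernel_decomposition.

(** * Moments of isotropic vectors *)

Section random_vector_measurability.
Context (R : realType) (p : nat).

Lemma measurable_coord (k : 'I_p) (j : 'I_1) :
  measurable_fun setT (fun v : borelcV R p => (v : 'cV[R]_p) k j).
Proof.
apply: (measurability _ (RGenOInfty.measurableE R)) => _ [_ [a ->] <-].
rewrite setTI; apply: sub_sigma_algebra.
apply: (open_comp (f := fun v : 'cV[R]_p => v k j)); last exact: rray_open.
by move=> v _; exact: coord_continuous.
Qed.

Context d (T : measurableType d).
Implicit Types X Y : T -> borelcV R p.

Lemma measurable_coord_comp X k j : measurable_fun setT X ->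
  measurable_fun setT (fun w => (X w : 'cV[R]_p) k j).
Proof. by move=> mX; apply: (measurableT_comp (measurable_coord k j)). Qed.

Lemma measurable_inner X Y : measurable_fun setT X -> measurable_fun setT Y ->
  measurable_fun setT (fun w => inner (X w : 'cV[R]_p) (Y w)).
Proof.
move=> mX mY; apply: measurable_sum => k.
by apply: measurable_funM; exact: measurable_coord_comp.
Qed.

Lemma measurable_enorm_sub_sqr X Y : measurable_fun setT X -> measurable_fun setT Y ->
  measurable_fun setT (fun w => enorm ((X w : 'cV[R]_p) - Y w) ^+ 2).
Proof.
move=> mX mY; under eq_fun do rewrite enorm_sub_sqr !enorm_sqr.
apply: measurable_funB; first by apply: measurable_funD; exact: measurable_inner.
by apply: measurable_funM => //; exact: measurable_inner.
Qed.

Lemma measurable_enorm X : measurable_fun setT X ->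
  measurable_fun setT (fun w => enorm (X w : 'cV[R]_p)).
Proof.
move=> mX.
apply: (measurableT_comp (continuous_measurable_fun (@sqrt_continuous R))).
apply: measurable_sum => k; apply: measurable_funX.
exact: measurable_coord_comp.
Qed.

End random_vector_measurability.

(** Domination by [u ^+ 2 + v ^+ 2], since the absolute value of [u * v] is at most half of it. *)
Lemma integrable_mul d (T : measurableType d) (R : realType)
    (m : {measure set T -> \bar R}) (u v : T -> R) :
  measurable_fun setT u -> measurable_fun setT v ->
  (\int[m]_w (u w * u w)%:E < +oo)%E -> (\int[m]_w (v w * v w)%:E < +oo)%E ->
  m.-integrable setT (EFin \o (fun w => u w * v w)).
Proof.
move=> mu mv iu iv.
have sqr_int (h : T -> R) : measurable_fun setT h -> (\int[m]_w (h w * h w)%:E < +oo)%E ->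
    m.-integrable setT (EFin \o (fun w => h w ^+ 2)).
  move=> mh ih; apply/integrableP; split.
    by apply/measurable_EFinP; apply: measurable_funX.
  rewrite (eq_integral (fun w => (h w * h w)%:E))//.
  by move=> w _; rewrite /= ger0_norm ?sqr_ge0// expr2.
apply: (le_integrable measurableT _ _
  (integrableD measurableT (sqr_int _ mu iu) (sqr_int _ mv iv))).
  by apply/measurable_EFinP; apply: measurable_funM.
move=> w _; rewrite /= lee_fin [leRHS]ger0_norm ?addr_ge0 ?sqr_ge0//.
rewrite ler_norml; have := sqr_ge0 (u w + v w); have := sqr_ge0 (u w - v w).
by have := sqr_ge0 (u w); have := sqr_ge0 (v w); rewrite sqrrB sqrrD; lra.
Qed.

Section moments.
Context (R : realType) (p : nat).
Let E := borelcV R p.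
Context (nu : probability E R).
Context (second_moments : forall a b : 'I_p,
  (\int[nu]_z ((z : 'cV[R]_p) a ord0 * (z : 'cV[R]_p) b ord0)%:E =
   ((a == b)%:R / p%:R)%:E)%E).

Let mz (a : 'I_p) : measurable_fun setT (fun z : E => (z : 'cV[R]_p) a ord0).
Proof. exact: measurable_coord. Qed.

Let int_mul a b : nu.-integrable setT
  (EFin \o (fun z : E => (z : 'cV[R]_p) a ord0 * (z : 'cV[R]_p) b ord0)).
Proof. by apply: integrable_mul => //; rewrite second_moments ltry. Qed.

(** Expanding the square, the covariance [I / p] retains only the terms with equal indices. *)
Lemma integral_inner_sqr (x : 'cV[R]_p) :
  (\int[nu]_z (inner x (z : 'cV[R]_p) ^+ 2)%:E = (enorm x ^+ 2 / p%:R)%:E)%E.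
Proof.
have -> : (fun z : E => (inner x (z : 'cV[R]_p) ^+ 2)%:E) =
  (fun z : E => \sum_(ab <- enum {: 'I_p * 'I_p}) ((x ab.1 ord0 * x ab.2 ord0)%:E *
     ((z : 'cV[R]_p) ab.1 ord0 * (z : 'cV[R]_p) ab.2 ord0)%:E))%E.
  apply/funext => z; rewrite expr2 /inner big_distrlr/= pair_big/= -sumEFin big_enum/=.
  by apply: eq_bigr => -[a b] _; rewrite -EFinM; congr EFin => /=; ring.
rewrite integral_sum//; last first.
  move=> ab; apply: integrableZl => //; exact: int_mul.
rewrite (eq_bigr (fun ab : 'I_p * 'I_p =>
    (x ab.1 ord0 * x ab.2 ord0 * ((ab.1 == ab.2)%:R / p%:R))%:E)%E); last first.
  by move=> ab _; rewrite integralZl//; [rewrite second_moments|exact: int_mul].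
rewrite sumEFin; congr EFin.
rewrite big_enum/= -(pair_big xpredT xpredT (fun a b => x a ord0 * x b ord0 * ((a == b)%:R / p%:R)))/=.
rewrite enorm_sqr mulr_suml; apply: eq_bigr => a _.
rewrite (bigD1 a)//= eqxx div1r big1 ?addr0// => b ba.
by rewrite eq_sym (negbTE ba) mul0r mulr0.
Qed.

Lemma integral_enorm_sqr : (0 < p)%N ->
  (\int[nu]_x (enorm (x : 'cV[R]_p) ^+ 2 / p%:R)%:E = (p%:R^-1)%:E)%E.
Proof.
move=> p0.
have -> : (fun x : E => (enorm (x : 'cV[R]_p) ^+ 2 / p%:R)%:E) =
  (fun x : E => \sum_(a <- enum 'I_p) (p%:R^-1)%:E *
     ((x : 'cV[R]_p) a ord0 * (x : 'cV[R]_p) a ord0)%:E)%E.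
  apply/funext => x; rewrite enorm_sqr /inner mulr_suml -sumEFin big_enum/=.
  by apply: eq_bigr => a _; rewrite -EFinM mulrC.
rewrite integral_sum//; last first.
  by move=> a; apply: integrableZl => //; exact: int_mul.
rewrite (eq_bigr (fun=> (p%:R^-1 * p%:R^-1)%:E)); last first.
  by move=> a _; rewrite integralZl//; [rewrite second_moments eqxx div1r|exact: int_mul].
rewrite sumEFin big_enum/= sumr_const card_ord; congr EFin.
by rewrite -[LHS]mulr_natl mulVKf// pnatr_eq0 -lt0n.
Qed.

(** Independence for the index set [{i, j}] identifies the joint law with the product measure on
    rectangles; uniqueness and Tonelli's theorem do the rest. *)
Lemma independent_pair_integral d (T : measurableType d) (P : probability T R) n
    (X : 'I_n -> {RV P >-> E}) (i j : 'I_n) (g : E * E -> \bar R) :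
  independent_family P X -> i != j ->
  (forall i B, measurable B -> P (X i @^-1` B) = nu B) ->
  measurable_fun setT g -> (forall z, 0 <= g z)%E ->
  (\int[P]_w g (X i w, X j w) = \int[nu]_x \int[nu]_y g (x, y))%E.
Proof.
move=> ind ij law mg g0.
pose Z (w : T) : E * E := (X i w, X j w).
have mZ : measurable_fun setT Z by apply: measurable_fun_pair; exact: measurable_funPT.
pose ZM := HB.pack Z (isMeasurableFun.Build _ _ _ _ Z mZ) : {mfun T >-> (E * E)%type}.
transitivity (\int[distribution P ZM]_z g z)%E.
  by rewrite ge0_integral_distribution.
rewrite -fubini_tonelli1//; apply: eq_measure_integral => B mB _.
apply/esym/product_measure_unique => // A C mA mC.
transitivity (P (Z @^-1` (A `*` C))) => //.
have -> : Z @^-1` (A `*` C) =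
    \bigcap_(k in [set` [set i; j]%SET]) (X k @^-1` (if k == i then A else C)).
  apply/seteqP; split => [w [wA wC] k /= | w wAC].
    by rewrite !inE => /orP[] /eqP ->; rewrite ?eqxx// eq_sym (negbTE ij).
  split; first by have := wAC i; rewrite /= !inE !eqxx; apply.
  by have := wAC j; rewrite /= !inE !eqxx orbT eq_sym (negbTE ij); apply.
rewrite ind; last by move=> k; case: ifP.
rewrite big_setU1/= ?inE// big_set1 eqxx eq_sym (negbTE ij).
by rewrite !law.
Qed.

Lemma integral_inner_sqr_pair d (T : measurableType d) (P : probability T R) n
    (X : 'I_n -> {RV P >-> E}) (i j : 'I_n) : (0 < p)%N ->
  independent_family P X -> i != j ->
  (forall i B, measurable B -> P (X i @^-1` B) = nu B) ->
  (\int[P]_w (inner (X i w : 'cV[R]_p) (X j w) ^+ 2)%:E = (p%:R^-1)%:E)%E.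
Proof.
move=> p0 ind ij law.
rewrite (@independent_pair_integral _ _ _ _ X i j
  (fun xy => (inner (xy.1 : 'cV[R]_p) (xy.2 : 'cV[R]_p) ^+ 2)%:E))//.
- under eq_integral do rewrite integral_inner_sqr.
  exact: integral_enorm_sqr.
- apply/measurable_EFinP; apply: measurable_funX.
  exact: measurable_inner.
- by move=> z; rewrite lee_fin sqr_ge0.
Qed.

Section total_deviation.
Context d (T : measurableType d) (P : probability T R) (n l : nat).
Context (X : 'I_n -> {RV P >-> E}).
Context (ind : independent_family P X).
Context (law : forall i B, measurable B -> P (X i @^-1` B) = nu B).
Context (p0 : (0 < p)%N).

Let x (w : T) (i : 'I_n) : 'cV[R]_p := X i w.

Lemma measurable_norm_dev i : measurable_fun setT (fun w => norm_dev l (x w) i).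
Proof.
apply: measurable_funX; apply: measurableT_comp => //.
by apply: measurable_funB => //; exact: measurable_enorm.
Qed.

Lemma integral_norm_dev i : (\int[P]_w (norm_dev l (x w) i)%:E =
  \int[nu]_z (`|enorm (z : 'cV[R]_p) - 1| ^+ (2 * l))%:E)%E.
Proof.
transitivity (\int[distribution P (X i)]_z (`|enorm (z : 'cV[R]_p) - 1| ^+ (2 * l))%:E)%E.
  rewrite ge0_integral_distribution//.
  apply/measurable_EFinP; apply: measurable_funX; apply: measurableT_comp => //.
  by apply: measurable_funB => //; exact: measurable_enorm.
by rewrite (@eq_measure_integral _ _ _ _ nu)// => B mB _; exact: law.
Qed.

Lemma measurable_total_dev : measurable_fun setT (fun w => total_dev l (x w)).
Proof.
apply: measurable_sum => i.
rewrite [X in measurable_fun _ X](_ : _ = (fun w => \sum_j if j != i then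
    norm_dev l (x w) i + norm_dev l (x w) j + inner (x w i) (x w j) ^+ 2 else 0)); last first.
  by apply/funext => w; rewrite big_mkcond.
apply: measurable_sum => j; case: (j != i) => //.
apply: measurable_funD; last by apply: measurable_funX; exact: measurable_inner.
by apply: measurable_funD; exact: measurable_norm_dev.
Qed.

(** At most [n * n] pairs, each of mean at most [2 * D + p%:R^-1]. With [D] of order 1/p and p of
    order n, the total is O(n). *)
Lemma integral_total_dev (D : R) : 0 <= D ->
  (\int[nu]_z (`|enorm (z : 'cV[R]_p) - 1| ^+ (2 * l))%:E <= D%:E)%E ->
  (\int[P]_w (total_dev l (x w))%:E <= (n%:R * (n%:R * (2 * D + p%:R^-1)))%:E)%E.
Proof.
move=> D0 hD.
pose G i j w : \bar R := if j != i then
  (norm_dev l (x w) i + norm_dev l (x w) j + inner (x w i) (x w j) ^+ 2)%:E else 0%E.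
have G0 i j w : (0 <= G i j w)%E.
  by rewrite /G; case: ifP => // _; rewrite lee_fin !addr_ge0 ?norm_dev_ge0 ?sqr_ge0.
have mG i j : measurable_fun setT (G i j).
  rewrite /G; case: (j != i) => //; apply/measurable_EFinP.
  apply: measurable_funD; last by apply: measurable_funX; exact: measurable_inner.
  by apply: measurable_funD; exact: measurable_norm_dev.
have -> : (fun w => (total_dev l (x w))%:E) = (fun w => \sum_i \sum_j G i j w)%E.
  apply/funext => w; rewrite /total_dev -sumEFin; apply: eq_bigr => i _.
  by rewrite big_mkcond/= -sumEFin; apply: eq_bigr => j _; rewrite /G; case: ifP.
rewrite ge0_integral_sum//; last 2 first.
- by move=> i; exact: emeasurable_sum.
- by move=> i w _; exact: sume_ge0.
have Gle i j : (\int[P]_w G i j w <= (2 * D + p%:R^-1)%:E)%E.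
  rewrite /G; have [->|ji] := eqVneq j i.
    by rewrite integral0 lee_fin addr_ge0 ?mulr_ge0 ?invr_ge0.
  under eq_integral do rewrite !EFinD.
  have m1 i' : measurable_fun setT (fun w => (norm_dev l (x w) i')%:E).
    by apply/measurable_EFinP; exact: measurable_norm_dev.
  rewrite ge0_integralD//; last 4 first.
  - by move=> w _; rewrite adde_ge0// lee_fin norm_dev_ge0.
  - exact: emeasurable_funD.
  - by move=> w _; rewrite lee_fin sqr_ge0.
  - by apply/measurable_EFinP; apply: measurable_funX; exact: measurable_inner.
  rewrite ge0_integralD//; last 2 first.
  - by move=> w _; rewrite lee_fin norm_dev_ge0.
  - by move=> w _; rewrite lee_fin norm_dev_ge0.
  rewrite !integral_norm_dev integral_inner_sqr_pair//; last by rewrite eq_sym.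
  by rewrite EFinD leeD// mulr2n mulrDl mul1r EFinD leeD.
apply: (@le_trans _ _ (\sum_(i < n) \sum_(j < n) (2 * D + p%:R^-1)%:E)%E).
  apply: lee_sum => i _; rewrite ge0_integral_sum//.
  by apply: lee_sum => j _; exact: Gle.
under eq_bigr do rewrite sumEFin sumr_const card_ord -[_ *+ n]mulr_natl.
by rewrite sumEFin sumr_const card_ord -[_ *+ n]mulr_natl.
Qed.

End total_deviation.

End moments.

(** * Empirical and mean spectral measures *)

Section spectral_measures.
Context (R : realType).
Local Notation realT := (measurableTypeR R).

(** Order statistics against counts: this transfers measurability from [below] to each single
    eigenvalue. *)
Lemma sorted_nth_le (s : seq R) (t : R) i : sorted <=%R s -> (i < size s)%N ->
  (s`_i <= t) = (i < count (fun x => x <= t)%R s)%N.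
Proof.
elim: s i => // x s IH [|i] /= xs; rewrite ?ltnS => si.
  case: (leP x t) => xt //=; rewrite add0n.
  suff -> : count (fun x => x <= t) s = 0%N by [].
  apply/eqP; rewrite -leqn0 leqNgt -has_count; apply/hasP => -[z zs zt].
  have /allP/(_ _ zs) := order_path_min le_trans xs.
  by rewrite leNgt (le_lt_trans zt xt).
case: (leP x t) => xt /=.
  by rewrite add1n ltnS; apply: IH => //; exact: path_sorted xs.
have all_gt : {in s, forall z, t < z}.
  by move=> z zs; have /allP/(_ _ zs) := order_path_min le_trans xs; exact: lt_le_trans.
rewrite leNgt all_gt ?mem_nth//= add0n; apply/esym/negbTE; rewrite -leqNgt.
suff -> : count (fun x => x <= t) s = 0%N by [].
by apply/eqP; rewrite -leqn0 leqNgt -has_count; apply/hasP => -[z /all_gt]; rewrite ltNge => /negP.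
Qed.

Lemma esdE n (B : 'M[R]_n) (A : set realT) : B^T = B ->
  esd B A = (n%:R^-1 * (count (fun x => x \in A) (eigenvalues B))%:R)%:E.
Proof.
move=> symB; have [sz _ _] := eigenvaluesP symB.
have -> : esd B A = ((n%:R^-1)%:E *
  \sum_(i < n) (((eigenvalues B)`_i \in A)%:R : R)%:E)%E by [].
rewrite sumEFin -EFinM; congr (_ * _)%:E.
rewrite -sum1_count natr_sum [RHS]big_mkcond (big_nth 0) big_mkord sz.
by apply: eq_bigr => i _; case: ifP.
Qed.

Lemma esd_ray n (B : 'M[R]_n) t : B^T = B ->
  esd B (`]-oo, t]%classic : set realT) = ((below B t)%:R / n%:R)%:E.
Proof.
move=> symB; rewrite esdE// mulrC; congr (_%:R / _)%:E.
by apply: eq_count => x; apply/idP/idP; rewrite inE /= in_itv.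
Qed.

Lemma esd_setT n (B : 'M[R]_n) : (0 < n)%N -> B^T = B ->
  esd B (setT : set realT) = 1%E.
Proof.
move=> n0 symB; rewrite esdE//.
rewrite (eq_count (a2 := predT)); last by move=> x; apply: mem_set.
have [sz _ _] := eigenvaluesP symB.
by rewrite count_predT sz mulVf// pnatr_eq0 -lt0n.
Qed.

Lemma esd_probability n (B : 'M[R]_n) : (0 < n)%N -> B^T = B ->
  exists q : probability realT R, (q : set realT -> \bar R) = esd B.
Proof.
move=> n0 symB.
pose q := HB.pack (esd B : set realT -> \bar R) (Measure.class (esd B))
  (Measure_isProbability.Build _ _ _ (esd B) (esd_setT n0 symB)) : probability realT R.
by exists q.
Qed.


Section random_matrix.
Context d (T : measurableType d) (P : probability T R) (n : nat) (B : T -> 'M[R]_n).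
Context (symB : forall w, (B w)^T = B w).
Context (mB : forall i j, measurable_fun setT (fun w => B w i j)).

Lemma measurable_belowR t : measurable_fun setT (fun w => (below (B w) t)%:R : R).
Proof.
apply: (measurability _ (RGenOInfty.measurableE R)) => _ [_ [a ->] <-].
rewrite setTI.
have [a0|a0] := ltP a 0.
  rewrite (_ : _ @^-1` _ = setT)//; apply/seteqP; split => // w _ /=.
  by rewrite in_itv/= andbT (lt_le_trans a0).
rewrite (_ : _ @^-1` _ = ~` [set w | (below (B w) t < (Num.truncn a).+1)%N]).
  by apply: measurableC; exact: measurable_below.
by apply/seteqP; split => w /=; rewrite in_itv/= andbT ltnS truncn_ge_nat// ltNge => /negP.
Qed.

Lemma measurable_eigenvalue i : (i < n)%N ->
  measurable_fun setT (fun w => (eigenvalues (B w))`_i).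
Proof.
move=> i_n; apply: (measurability _ (RGenOInfty.measurableE R)) => _ [_ [a ->] <-].
rewrite setTI.
rewrite (_ : _ @^-1` _ = [set w | (below (B w) a < i.+1)%N]); first exact: measurable_below.
apply/seteqP; split => w /=; have [sz so _] := eigenvaluesP (symB w);
  by rewrite in_itv/= andbT ltNge sorted_nth_le ?sz// ltnS -leqNgt.
Qed.

Lemma measurable_esd (A : set realT) : measurable A ->
  measurable_fun setT (fun w => esd (B w) A).
Proof.
move=> mA.
rewrite (_ : (fun w => _) = (fun w => (n%:R^-1)%:E *
    \sum_(i < n) (\1_A ((eigenvalues (B w))`_i))%:E)%E); last first.
  by apply/funext => w; rewrite /esd /mscale/= /msum.
apply: emeasurable_funM => //; apply: emeasurable_sum => i.
apply/measurable_EFinP.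
apply: (@measurableT_comp _ _ _ _ _ _ (\1_A : realT -> R)); first exact: measurable_indic.
exact: measurable_eigenvalue.
Qed.

(** [mean_esd] is given only as a set function; its countable additivity comes from exchanging the
    integral with a nonnegative series. *)
Lemma mean_esd_pushforward_probability (phi : R -> R) : (0 < n)%N ->
  measurable_fun [set: realT] (phi : realT -> realT) ->
  exists q : probability realT R,
    (q : set realT -> \bar R) = pushforward (mean_esd P B) (phi : realT -> realT).
Proof.
move=> n0 mphi; pose mu := pushforward (mean_esd P B) (phi : realT -> realT).
have mpre (A : set realT) : measurable A -> measurable ((phi : realT -> realT) @^-1` A).
  by move=> mA; rewrite -[X in measurable X]setTI; exact: mphi.
have mu0 : mu set0 = 0%E.
  rewrite /mu /pushforward preimage_set0 /mean_esd.
  by rewrite integral0_eq// => w _; rewrite measure0.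
have mu_ge0 A : (0 <= mu A)%E by apply: integral_ge0 => w _; exact: measure_ge0.
have mu_additive : semi_sigma_additive mu.
  move=> F mF tF mUF.
  rewrite [X in _ --> X](_ : _ = (\sum_(k <oo) mu (F k))%E).
    by apply/cvg_closeP; split; [exact: is_cvg_nneseries|rewrite closeE].
  rewrite /mu /pushforward /mean_esd -integral_nneseries//; last first.
    by move=> k; apply: measurable_esd; exact: mpre.
  apply: eq_integral => w _; apply/esym/cvg_lim => //.
  rewrite preimage_bigcup; apply: measure_semi_sigma_additive => //.
  - by move=> k; exact: mpre.
  - by move=> i j _ _ [x [xi xj]]; apply: (tF i j) => //; exists (phi x).
  - by rewrite -preimage_bigcup; exact: mpre.
have mu1 : mu setT = 1%E.
  rewrite /mu /pushforward preimage_setT /mean_esd.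
  under eq_integral do rewrite esd_setT//.
  exact: (integral_probability_cst P 1%E).
pose m := HB.pack mu (isMeasure.Build _ _ _ mu mu0 mu_ge0 mu_additive)
  : {measure set realT -> \bar R}.
pose q := HB.pack mu (Measure.class m)
  (Measure_isProbability.Build _ _ _ m mu1) : probability realT R.
by exists q.
Qed.

End random_matrix.

(** Off [O] the bound [F <= 1] is used, so that [F <= G + c + k * Y] holds everywhere once the
    indicator of the complement is added. *)
Lemma expect_dominated d (T : measurableType d) (P : probability T R)
    (F G Y : T -> R) (O : set T) (c k D : R) :
  measurable O -> measurable_fun setT F -> measurable_fun setT G ->
  measurable_fun setT Y ->
  (forall w, 0 <= F w <= 1) -> (forall w, 0 <= G w <= 1) -> (forall w, 0 <= Y w) ->
  (\int[P]_w (Y w)%:E <= D%:E)%E -> 0 <= k -> 0 <= c ->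
  (forall w, O w -> F w <= G w + c + k * Y w) ->
  \int[P]_w F w <= \int[P]_w G w + c + (1 - fine (P O)) + k * D.
Proof.
move=> mO mF mG mY F01 G01 Y0 YD k0 c0 FG.
have Fi : P.-integrable setT (EFin \o F).
  by apply: (@bounded_integrable _ _ _ _ _ 1) => // w; have /andP[? ?] := F01 w; rewrite ger0_norm.
have Gi : P.-integrable setT (EFin \o G).
  by apply: (@bounded_integrable _ _ _ _ _ 1) => // w; have /andP[? ?] := G01 w; rewrite ger0_norm.
have Yi : P.-integrable setT (EFin \o Y).
  apply/integrableP; split; first exact/measurable_EFinP.
  rewrite (eq_integral (EFin \o Y)).
    by apply: le_lt_trans YD _; exact: ltry.
  by move=> w _; rewrite /= ger0_norm.
have ci : P.-integrable setT (EFin \o cst c).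
  by apply: (@bounded_integrable _ _ _ _ _ `|c|).
have Oi : P.-integrable setT (EFin \o (fun w => \1_(~` O) w)).
  apply: (@bounded_integrable _ _ _ _ _ 1).
    by apply: measurable_indic; exact: measurableC.
  by move=> w; rewrite indicE; case: (w \in _); rewrite ?normr1 ?normr0.
have kYi : P.-integrable setT (EFin \o (fun w => k * Y w)) by exact: (integrableZl measurableT _ Yi).
have Gci : P.-integrable setT (EFin \o (fun w => G w + c)) by exact: (integrableD measurableT Gi ci).
have GcOi : P.-integrable setT (EFin \o (fun w => G w + c + \1_(~` O) w)).
  exact: (integrableD measurableT Gci Oi).
apply: (@le_trans _ _ (\int[P]_w (G w + c + \1_(~` O) w + k * Y w))).
  apply: le_Rintegral => //; first exact: (integrableD measurableT GcOi kYi).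
  move=> w _; have /andP[_ F1] := F01 w; have /andP[G0 _] := G01 w.
  have kY : 0 <= k * Y w by rewrite mulr_ge0.
  rewrite indicE in_setC; case: (boolP (w \in O)) => /= [|_].
    by rewrite inE => /FG; rewrite addr0.
  by move: F1 G0 kY c0; rewrite /=; lra.
rewrite RintegralD// RintegralD// RintegralD// (Rintegral_probability_cst P) RintegralZl//.
rewrite !lerD//.
  rewrite /Rintegral integral_indic//; last exact: measurableC.
  by rewrite setIT/= probability_setC// fineB// fin_num_measure.
rewrite ler_wpM2l//.
by rewrite -lee_fin EFin_Rintegral.
Qed.

End spectral_measures.

(** * Kernel matrices of random vectors *)

Section rank_perturbation.
Context (R : realType).

(** Subtracting the rank-one matrix that carries row [i] leaves a matrix supported on column [i]. *)
Lemma rank_cross n (M : 'M[R]_n) i :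
  (forall j k, j != i -> k != i -> M j k = 0) -> (\rank M <= 2)%N.
Proof.
move=> M0; pose N := M - delta_mx i 0 *m row i M.
have NE : N = col i N *m delta_mx 0 i :> 'M[R]_n.
  apply/matrixP => j k; rewrite !mxE !big_ord1 !mxE !big_ord1 !mxE eqxx !andbT/=.
  case: (eqVneq k i) => [->|ki]; first by rewrite mulr1.
  rewrite mulr0; case: (eqVneq j i) => [->|ji]; first by rewrite mul1r subrr.
  by rewrite M0// mul0r subrr.
have -> : M = delta_mx i (0 : 'I_1) *m row i M + N by rewrite addrC subrK.
rewrite (leq_trans (mxrank_add _ _))// -[2%N]/(1 + 1)%N leq_add//.
  by rewrite (leq_trans (mxrankM_maxl _ _))// rank_leq_col.
by rewrite NE (leq_trans (mxrankM_maxl _ _))// rank_leq_col.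
Qed.

(** The case [E = 0] of the perturbation inequality, with a shift so small that the count of [B]
    does not see it. *)
Lemma below_rank_le n (A B : 'M[R]_n) t : A^T = A -> B^T = B ->
  (below A t <= below B t + \rank (A - B)%R)%N.
Proof.
move=> sA sB; have [e e0 <-] := below_right_constant B t.
have s0 : (0 : 'M[R]_n)^T = 0 by rewrite trmx0.
have := below_perturb_sqnorm t sA sB s0 e0.
rewrite subr0 /sqnorm big1 ?mul0r ?addr0; last first.
  by move=> i _; rewrite big1// => j _; rewrite mxE expr0n.
by rewrite -natrD ler_nat.
Qed.

End rank_perturbation.

Section random_kernel_matrix.
Context (R : realType) (p n : nat) (f : R -> R).
Context (mf : measurable_fun (`[0, +oo[%classic : set R) f).
Let E := borelcV R p.

Lemma measurable_kernel_entry d (T : measurableType d) (X Y : T -> E) :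
  measurable_fun setT X -> measurable_fun setT Y ->
  measurable_fun setT (fun w => f (enorm ((X w : 'cV[R]_p) - Y w) ^+ 2)).
Proof.
move=> mX mY.
apply: (measurable_comp (F := (`[0, +oo[%classic : set R)) _ _ mf).
- exact: measurable_itv.
- by move=> _ [w _ <-]; rewrite /= in_itv/= andbT sqr_ge0.
- exact: measurable_enorm_sub_sqr.
Qed.

Definition kernel_cdf (t : R) (v : n.-tuple E) : R :=
  (below (kernel_mx f (fun i => tnth v i : 'cV[R]_p)) t)%:R / n%:R.

Lemma measurable_kernel_cdf t : measurable_fun setT (kernel_cdf t).
Proof.
apply: measurable_funM => //.
apply: (@measurable_belowR _ _ _ _
  (fun v : n.-tuple E => kernel_mx f (fun i => tnth v i : 'cV[R]_p))) => [v|i j].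
  exact: kernel_mx_sym.
rewrite [X in measurable_fun _ X](_ : _ = (fun v : n.-tuple E =>
    f (enorm ((tnth v i : 'cV[R]_p) - tnth v j) ^+ 2))); last first.
  by apply/funext => v; rewrite mxE.
by apply: measurable_kernel_entry; exact: measurable_tnth.
Qed.

Lemma below_ratio_bounds (B : 'M[R]_n) t : B^T = B ->
  0 <= ((below B t)%:R / n%:R : R) <= 1.
Proof.
(* For [n = 0] the quotient is 0, the inverse of 0 being 0. *)
move=> symB; have [n0|n0] := posnP n.
  have -> : n%:R^-1 = 0 :> R by rewrite n0 invr0.
  by rewrite mulr0 lexx ler01.
by rewrite divr_ge0//= ler_pdivrMr ?ltr0n// mul1r ler_nat below_le.
Qed.

Lemma kernel_cdf_bounded_differences t : bounded_differences (kernel_cdf t) (2 / n%:R).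
Proof.
move=> i v u vu; rewrite /kernel_cdf.
set A := kernel_mx _ _; set B := kernel_mx _ _.
have n0 : 0 < n%:R :> R by rewrite ltr0n (leq_ltn_trans _ (ltn_ord i)).
have sA : A^T = A by exact: kernel_mx_sym.
have sB : B^T = B by exact: kernel_mx_sym.
have cross (M N : 'M[R]_n) :
    (forall j k, j != i -> k != i -> M j k = N j k) -> (\rank (M - N)%R <= 2)%N.
  move=> MN; apply: (@rank_cross _ _ _ i) => j k ji ki.
  by rewrite !mxE MN// subrr.
have AB j k : j != i -> k != i -> A j k = B j k by move=> ji ki; rewrite !mxE !vu.
have h1 := leq_trans (below_rank_le t sA sB) (leq_add (leqnn _) (cross A B AB)).
have BA j k : j != i -> k != i -> B j k = A j k by move=> ji ki; rewrite AB.
have h2 := leq_trans (below_rank_le t sB sA) (leq_add (leqnn _) (cross B A BA)).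
rewrite -mulrBl normrM [`|n%:R^-1|]gtr0_norm ?invr_gt0//.
rewrite ler_wpM2r ?invr_ge0 ?(ltW n0)// ler_norml.
move: (below A t) (below B t) h1 h2 => a b h1 h2.
have {}h1 : a%:R <= b%:R + 2 :> R by rewrite -natrD ler_nat.
have {}h2 : b%:R <= a%:R + 2 :> R by rewrite -natrD ler_nat.
by clear -h1 h2; lra.
Qed.

End random_kernel_matrix.

(** * The event of a nearly regular simplex *)

Section simplex_event.
Context (R : realType) (p n : nat) d (T : measurableType d) (X : 'I_n -> T -> borelcV R p).
Context (mX : forall i, measurable_fun setT (X i)).

Definition simplex_event (e : R) : set T :=
  [set w | near_simplex (fun i => X i w : 'cV[R]_p) e].

Lemma measurable_simplex_event e : measurable (simplex_event e).
Proof.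
rewrite (_ : simplex_event e =
  (\bigcap_i [set w | `|enorm (X i w : 'cV[R]_p) ^+ 2 - 1| <= e]) `&`
  (\bigcap_(ij in [set ij : 'I_n * 'I_n | ij.1 != ij.2])
    [set w | `|enorm ((X ij.1 w : 'cV[R]_p) - X ij.2 w) ^+ 2 - 2| <= e])); last first.
  apply/seteqP; split => [w [h1 h2]|w [h1 h2]].
    by split => [i _|[i j] ij]; [exact: h1|exact: h2].
  by split => [i|i j ij]; [exact: h1|exact: (h2 (i, j))].
apply: measurableI; apply: fin_bigcap_measurable; try exact: finite_finset.
  move=> i _; apply: measurable_set_ler => //; apply: measurableT_comp => //.
  apply: measurable_funB => //; apply: measurable_funX; exact: measurable_enorm.
move=> [i j] _; apply: measurable_set_ler => //; apply: measurableT_comp => //.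
by apply: measurable_funB => //; exact: measurable_enorm_sub_sqr.
Qed.

(** The maximum mentions the norm of a vector only together with a second index, so a different [j]
    must exist for every [i]; hence [1 < n]. *)
Lemma simplex_eventE e : (1 < n)%N -> 0 <= e ->
  [set w | \big[Num.max/0]_(ij : 'I_n * 'I_n | ij.1 != ij.2)
     Num.max `|enorm ((X ij.1 w : 'cV[R]_p) - X ij.2 w) ^+ 2 - 2|
             `|enorm (X ij.1 w : 'cV[R]_p) ^+ 2 - 1| <= e] = simplex_event e.
Proof.
move=> n1 e0; apply/seteqP; split => w /=.
  move=> h.
  have {}h i j : i != j ->
      (`|enorm ((X i w : 'cV[R]_p) - X j w) ^+ 2 - 2| <= e) /\
      (`|enorm (X i w : 'cV[R]_p) ^+ 2 - 1| <= e).
    move=> ij; apply/andP; rewrite -ge_max; apply: le_trans h.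
    exact: (le_bigmax_cond _ (fun ij : 'I_n * 'I_n =>
      Num.max `|enorm ((X ij.1 w : 'cV[R]_p) - X ij.2 w) ^+ 2 - 2|
             `|enorm (X ij.1 w : 'cV[R]_p) ^+ 2 - 1|) (j := (i, j)) ij).
  split => [i|i j ij]; last by have [] := h i j ij.
  have [j ij] : exists j, i != j.
    have [i0|i0] := eqVneq (i : nat) 0%N.
      by exists (Ordinal n1); apply/eqP => /(congr1 val)/=; rewrite i0.
    by exists (Ordinal (ltnW n1)); apply/eqP => /(congr1 val)/=; apply/eqP.
  by have [] := h i j ij.
move=> [h1 h2]; apply: bigmax_le => // -[i j] /= ij.
by rewrite ge_max h1 h2.
Qed.

End simplex_event.

(** * Comparison of expected counting functions *)

Section expected_counts.
Context (R : realType) (p n l : nat) (f : R -> R).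
Context (mf : measurable_fun (`[0, +oo[%classic : set R) f).
Context d (T : measurableType d) (P : probability T R).
Context (X : 'I_n -> {RV P >-> borelcV R p}).
Context (nu : probability (borelcV R p) R).
Context (second_moments : forall a b : 'I_p,
  (\int[nu]_z ((z : 'cV[R]_p) a ord0 * (z : 'cV[R]_p) b ord0)%:E =
   ((a == b)%:R / p%:R)%:E)%E).
Context (ind : independent_family P X).
Context (law : forall i B, measurable B -> P (X i @^-1` B) = nu B).
Context (p0 : (0 < p)%N) (n0 : (0 < n)%N).
Context (D : R).
Context (D0 : 0 <= D).
Context (hD :
  (\int[nu]_z (`|enorm (z : 'cV[R]_p) - 1| ^+ (2 * l))%:E <= D%:E)%E).

Let x (w : T) (i : 'I_n) : 'cV[R]_p := X i w.

Definition kernel_count t w : R := (below (kernel_mx f (x w)) t)%:R / n%:R.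
Definition linear_count t w : R := (below (linear_mx f (x w)) t)%:R / n%:R.
Definition mean_dev w : R := 1 + total_dev l (x w) / n%:R.
Definition mean_dev_bound : R := 1 + n%:R * (2 * D + p%:R^-1).
Definition simplex_defect e : R := 1 - fine (P (simplex_event X e)).

Let n0R : 0 < n%:R :> R. Proof. by rewrite ltr0n. Qed.

Lemma measurable_kernel_count t : measurable_fun setT (kernel_count t).
Proof.
apply: measurable_funM => //.
apply: (@measurable_belowR _ _ _ _ (fun w => kernel_mx f (x w))) => [w|i j].
  exact: kernel_mx_sym.
rewrite [X in measurable_fun _ X](_ : _ = (fun w =>
    f (enorm ((X i w : 'cV[R]_p) - X j w) ^+ 2))); last first.
  by apply/funext => w; rewrite mxE.
exact: measurable_kernel_entry.
Qed.

Lemma measurable_gram_entry i j : measurable_fun setT (fun w => gram_mx (x w) i j).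
Proof.
rewrite [X in measurable_fun _ X](_ : _ = (fun w => inner (x w i) (x w j))).
  exact: measurable_inner.
by apply/funext => w; rewrite mxE.
Qed.

Lemma measurable_linear_count t : measurable_fun setT (linear_count t).
Proof.
apply: measurable_funM => //.
apply: (@measurable_belowR _ _ _ _ (fun w => linear_mx f (x w))) => [w|i j].
  exact: linear_mx_sym.
rewrite [X in measurable_fun _ X](_ : _ = (fun w =>
  (f 0 - f 2 + 2 * derive1 f 2) *+ (i == j) + - (2 * derive1 f 2) * gram_mx (x w) i j)); last first.
  by apply/funext => w; rewrite /linear_mx !mxE.
by apply: measurable_funD => //; apply: measurable_funM => //; exact: measurable_gram_entry.
Qed.

Lemma measurable_mean_dev : measurable_fun setT mean_dev.
Proof.
by apply: measurable_funD => //; apply: measurable_funM => //; exact: measurable_total_dev.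
Qed.

Lemma total_dev_ge0 w : 0 <= total_dev l (x w).
Proof.
apply: sumr_ge0 => i _; apply: sumr_ge0 => j _.
by rewrite !addr_ge0 ?norm_dev_ge0 ?sqr_ge0.
Qed.

Lemma mean_dev_ge0 w : 0 <= mean_dev w.
Proof. by rewrite addr_ge0// divr_ge0// total_dev_ge0. Qed.

Lemma mean_devE w : n%:R + total_dev l (x w) = mean_dev w * n%:R.
Proof. by rewrite /mean_dev mulrDl mul1r divfK// gt_eqF. Qed.

Lemma integral_mean_dev : (\int[P]_w (mean_dev w)%:E <= mean_dev_bound%:E)%E.
Proof.
rewrite (eq_integral (fun w => 1%:E + (n%:R^-1)%:E * (total_dev l (x w))%:E)%E); last first.
  by move=> w _; rewrite -EFinM -EFinD mulrC.
have mt : measurable_fun setT (fun w => (total_dev l (x w))%:E).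
  by apply/measurable_EFinP; exact: measurable_total_dev.
rewrite ge0_integralD//; last 2 first.
- by move=> w _; rewrite mule_ge0// lee_fin ?invr_ge0// total_dev_ge0.
- exact: emeasurable_funM.
rewrite ge0_integralZl//; last by move=> w _; rewrite lee_fin total_dev_ge0.
rewrite (integral_probability_cst P 1%:E) /mean_dev_bound EFinD leeD2l//.
have h := integral_total_dev second_moments ind law p0 D0 hD.
apply: le_trans (lee_wpmul2l _ h) _; first by rewrite lee_fin invr_ge0.
by rewrite -EFinM lee_fin mulKf// gt_eqF.
Qed.

Let kc01 t w : 0 <= kernel_count t w <= 1.
Proof. by apply: below_ratio_bounds; exact: kernel_mx_sym. Qed.

Let lc01 t w : 0 <= linear_count t w <= 1.
Proof. by apply: below_ratio_bounds; exact: linear_mx_sym. Qed.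

Let mO e : measurable (simplex_event X e).
Proof. by apply: measurable_simplex_event => i. Qed.

Lemma compare_expected_counts (e eta k t : R) (s : nat) : 0 < k -> 0 <= eta ->
  (forall y : 'I_n -> 'cV[R]_p, near_simplex y e ->
    exists L : 'M[R]_n, [/\ L^T = L, (\rank L <= s)%N &
      sqnorm (kernel_mx f y - linear_mx f y - L) <= eta * (n%:R + total_dev l y)]) ->
  \int[P]_w kernel_count t w <= \int[P]_w linear_count (t + k) w +
    s%:R / n%:R + simplex_defect e + eta / k ^+ 2 * mean_dev_bound /\
  \int[P]_w linear_count t w <= \int[P]_w kernel_count (t + k) w +
    s%:R / n%:R + simplex_defect e + eta / k ^+ 2 * mean_dev_bound.
Proof.
move=> k0 eta0 H.
(* Stated for two arbitrary families of matrices, to serve in both directions of the comparison. *)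
have dom (A B : T -> 'M[R]_n) (FA FB : R -> T -> R) :
    (forall w, (A w)^T = A w) -> (forall w, (B w)^T = B w) ->
    (forall t w, FA t w = (below (A w) t)%:R / n%:R) ->
    (forall t w, FB t w = (below (B w) t)%:R / n%:R) ->
    (forall w, near_simplex (x w) e -> exists L : 'M[R]_n,
      [/\ L^T = L, (\rank L <= s)%N &
        sqnorm (A w - B w - L) <= eta * (n%:R + total_dev l (x w))]) ->
    forall w, simplex_event X e w ->
      FA t w <= FB (t + k) w + s%:R / n%:R + eta / k ^+ 2 * mean_dev w.
  move=> sA sB FAE FBE HAB w /HAB[L [sL rL hL]]; rewrite FAE FBE.
  have sE : (A w - B w - L)^T = A w - B w - L by rewrite !linearB/= sA sB sL.
  have := below_perturb_sqnorm t (sA w) (sB w) sE k0.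
  rewrite subKr; move: (below (A w) t) (below (B w) _) => a b h.
  have kn : 0 < k ^+ 2 by rewrite exprn_gt0.
  have h1 : a%:R <= b%:R + s%:R + eta / k ^+ 2 * mean_dev w * n%:R :> R.
    apply: le_trans h _; rewrite lerD ?lerD2l ?ler_nat//.
    by rewrite ler_pdivrMr// -mulrA -mean_devE mulrAC divfK ?gt_eqF// hL.
  by rewrite ler_pdivrMr// !mulrDl !divfK ?gt_eqF.
have sK w : (kernel_mx f (x w))^T = kernel_mx f (x w) by exact: kernel_mx_sym.
have sL w : (linear_mx f (x w))^T = linear_mx f (x w) by exact: linear_mx_sym.
have c0 : 0 <= s%:R / n%:R :> R by rewrite divr_ge0.
have k20 : 0 <= eta / k ^+ 2 by rewrite divr_ge0// sqr_ge0.
have dev_kl w : near_simplex (x w) e -> exists L : 'M[R]_n,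
    [/\ L^T = L, (\rank L <= s)%N &
      sqnorm (kernel_mx f (x w) - linear_mx f (x w) - L) <=
        eta * (n%:R + total_dev l (x w))].
  exact: H.
split.
  exact: (expect_dominated (mO e) (measurable_kernel_count t)
    (measurable_linear_count (t + k)) measurable_mean_dev (kc01 t) (lc01 (t + k))
    mean_dev_ge0 integral_mean_dev k20 c0
    (dom _ _ kernel_count linear_count sK sL (fun _ _ => erefl) (fun _ _ => erefl)
      dev_kl)).
apply: (expect_dominated (mO e) (measurable_linear_count t)
  (measurable_kernel_count (t + k)) measurable_mean_dev (lc01 t) (kc01 (t + k))
  mean_dev_ge0 integral_mean_dev k20 c0).
apply: (dom _ _ linear_count kernel_count sL sK (fun _ _ => erefl) (fun _ _ => erefl)).
move=> w /dev_kl[L [symL rL hL]].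
(* Exchanging the two matrices changes the sign of the error, so the low-rank part changes sign as
   well. *)
exists (- L); split; first by rewrite linearN/= symL.
  by rewrite mxrank_opp.
rewrite (_ : sqnorm _ = sqnorm (kernel_mx f (x w) - linear_mx f (x w) - L))//.
apply: eq_bigr => i _; apply: eq_bigr => j _; rewrite -[LHS]sqrrN; congr (_ ^+ 2).
by rewrite !mxE; ring.
Qed.

Definition linear_mx_scale : R :=
  2 * (f 0 - f 2 + 2 * derive1 f 2) ^+ 2 + 32 * (derive1 f 2) ^+ 2.

(** Chebyshev for the spectrum of [linear_mx]: on the good event its squared Hilbert-Schmidt norm
    divided by [n] is at most a constant times [mean_dev]. *)
Lemma tight_linear_count (e K : R) : 0 < K -> 0 < e <= 4^-1 ->
  \int[P]_w linear_count (- K) w <=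
    simplex_defect e + linear_mx_scale / K ^+ 2 * mean_dev_bound /\
  1 - \int[P]_w linear_count K w <=
    simplex_defect e + linear_mx_scale / K ^+ 2 * mean_dev_bound.
Proof.
move=> K0 /andP[e0 e4].
have sc0 : 0 <= linear_mx_scale.
  by rewrite /linear_mx_scale addr_ge0// mulr_ge0// sqr_ge0.
have K20 : 0 < K ^+ 2 by rewrite exprn_gt0.
have c0 : 0 <= linear_mx_scale / K ^+ 2 by rewrite divr_ge0// ltW.
have sL w : (linear_mx f (x w))^T = linear_mx f (x w) by exact: linear_mx_sym.
have cnt (q : pred R) w : (forall y, q y -> K <= `|y|) -> simplex_event X e w ->
    (count q (eigenvalues (linear_mx f (x w))))%:R / n%:R <=
    linear_mx_scale / K ^+ 2 * mean_dev w.
  move=> qK we; rewrite ler_pdivrMr// -[leRHS]mulrA -mean_devE mulrAC ler_pdivlMr//.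
  apply: le_trans (count_eigenvalues_sqnorm (sL w) (ltW K0) qK) _.
  exact: (sqnorm_linear_mx f l e4 we).
have lci t : P.-integrable setT (EFin \o linear_count t).
  apply: (@bounded_integrable _ _ _ _ _ 1) => [|w]; first exact: measurable_linear_count.
  by have /andP[? ?] := lc01 t w; rewrite ger0_norm.
have i1 : P.-integrable setT (EFin \o cst (1 : R)).
  by apply: (@bounded_integrable _ _ _ _ _ 1) => // w; rewrite normr1.
have -> : 1 - \int[P]_w linear_count K w = \int[P]_w (1 - linear_count K w).
  by rewrite RintegralB// (Rintegral_probability_cst P).
have zero (u v : R) : \int[P]_w cst 0 w + 0 + u + v = u + v.
  by rewrite (Rintegral_probability_cst P) !add0r.
have c01 w : 0 <= cst (0 : R) (w : T) <= 1 by rewrite lexx ler01.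
have m0 : measurable_fun setT (cst (0 : R) : T -> R) by exact: measurable_cst.
split.
  rewrite -(zero (simplex_defect e)).
  apply: (expect_dominated (mO e) (measurable_linear_count (- K)) m0
    measurable_mean_dev (lc01 (- K)) c01 mean_dev_ge0 integral_mean_dev c0 (lexx 0)).
  move=> w we; rewrite addr0 add0r; apply: cnt => // y yK.
  by rewrite ler_normr lerNr yK orbT.
have m1 : measurable_fun setT (fun w => 1 - linear_count K w).
  by apply: measurable_funB => //; exact: measurable_linear_count.
have h1 w : 0 <= 1 - linear_count K w <= 1.
  by have /andP[a b] := lc01 K w; rewrite subr_ge0 b lerBlDr lerDl a.
rewrite -(zero (simplex_defect e)).
apply: (expect_dominated (mO e) m1 m0
  measurable_mean_dev h1 c01 mean_dev_ge0 integral_mean_dev c0 (lexx 0)).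
move=> w we; rewrite addr0 add0r.
have -> : 1 - linear_count K w =
    (count (predC (fun y => y <= K)) (eigenvalues (linear_mx f (x w))))%:R / n%:R.
  have [sz _ _] := eigenvaluesP (sL w).
  have := count_predC (fun y => y <= K) (eigenvalues (linear_mx f (x w))).
  rewrite sz /linear_count /below => nE.
  have nE' : n%:R = (count (fun y => y <= K) (eigenvalues (linear_mx f (x w))))%:R +
    (count (predC (fun y => y <= K)) (eigenvalues (linear_mx f (x w))))%:R :> R.
    by rewrite -natrD nE.
  move: (count _ _) (count _ _) nE' => a b nE'.
  have -> : a%:R = n%:R - b%:R :> R by rewrite nE'; ring.
  by rewrite mulrBl divff// gt_eqF.
apply: cnt => // y; rewrite /= -ltNge => /ltW yK.
by rewrite ler_normr yK.
Qed.

(** The affine map is moved into the matrix, whose eigenvalues it transforms one by one; the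
    argument is the same for every sign of the slope, including slope 0. *)
Lemma mean_esd_affine_ray t :
  pushforward (mean_esd P (fun w => gram_mx (x w)))
    ((fun s : R => f 0 - f 2 + 2 * derive1 f 2 - 2 * derive1 f 2 * s)
      : measurableTypeR R -> measurableTypeR R)
    `]-oo, t]%classic = (\int[P]_w linear_count t w)%:E.
Proof.
rewrite EFin_Rintegral; last first.
  apply: (@bounded_integrable _ _ _ _ _ 1) => [|w]; first exact: measurable_linear_count.
  by have /andP[? ?] := lc01 t w; rewrite ger0_norm.
rewrite /pushforward /mean_esd; apply: eq_integral => w _.
rewrite esdE ?gram_mx_sym// mulrC /linear_count; congr (_%:R / _)%:E.
rewrite /below /linear_mx.
have /permP -> := eigenvalues_affine (f 0 - f 2 + 2 * derive1 f 2) (- (2 * derive1 f 2))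
  (gram_mx_sym (x w)).
rewrite count_map; apply: eq_count => y /=.
by apply/idP/idP; rewrite inE /= in_itv/= mulNr.
Qed.

End expected_counts.

(** * Conclusion *)

Lemma isotropic_second_moments (R : realType) d (T : measurableType d)
    (Q : probability T R) p (Y : {RV Q >-> borelcV R p}) : isotropic Q Y ->
  forall a b : 'I_p,
  (\int[distribution Q Y]_z ((z : 'cV[R]_p) a ord0 * (z : 'cV[R]_p) b ord0)%:E =
   ((a == b)%:R / p%:R)%:E)%E.
Proof.
move=> [_ cov] a b.
have covE i j : (\int[Q]_w ((Y w : 'cV[R]_p) i ord0 * (Y w : 'cV[R]_p) j ord0)%:E =
    ((i == j)%:R / p%:R)%:E)%E.
  have := cov i j; rewrite unlock => h.
  rewrite (_ : (_ / _)%:E = ((p%:R^-1 *: 1%:M : 'M[R]_p) i j)%:E).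
    by rewrite -h; apply: eq_integral => w _; rewrite !mxE big_ord1 !mxE.
  by rewrite !mxE mulrC.
have mY k : measurable_fun setT (fun w => (Y w : 'cV[R]_p) k ord0).
  exact: measurable_coord_comp.
rewrite integral_distribution; first exact: covE.
  by apply/measurable_EFinP; apply: measurable_funM; exact: measurable_coord.
by apply: integrable_mul => //; rewrite covE ltry.
Qed.

Lemma ae_forall_rat d (T : measurableType d) (R : realType) (P : probability T R)
    (S : rat -> T -> Prop) :
  (forall q, {ae P, forall w, S q w}) -> {ae P, forall w, forall q, S q w}.
Proof.
move=> SP.
have negl : P.-negligible
    (\bigcup_k ~` [set w | forall q, unpickle k = Some q -> S q w]).
  apply: negligible_bigcup => k; case E: (unpickle k : option rat) => [q|].
    apply: negligibleS (SP q) => w /=; apply: contra_not => Sw q' [<-].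
    exact: Sw.
  by apply: negligibleS (negligible_set0 P) => w /=; apply.
apply: negligibleS negl.
move=> w /= /existsNP[q Sq]; exists (pickle q) => // /(_ q); apply: contra_not Sq.
by apply; rewrite pickleK.
Qed.

Section error_budget.
Context (F : realFieldType).
Implicit Types a b e u v : F.

Lemma le_add_thirds u v a b c e : v <= u + a + b + c ->
  a <= e / 3 -> b <= e / 3 -> c <= e / 3 -> v <= u + e.
Proof. lra. Qed.

Lemma le_halves v a b e : v <= a + b -> a <= e / 2 -> b <= e / 2 -> v <= e.
Proof. lra. Qed.

Lemma le_dist_halves a b v e : v <= b + e / 2 -> `|a - v| <= e / 2 -> a <= b + e.
Proof. by rewrite ler_norml; lra. Qed.

Lemma ge_dist_halves a a' b v e :
  b <= v + e / 2 -> `|a - v| <= e / 2 -> a <= a' -> b <= a' + e.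
Proof. by rewrite ler_norml; lra. Qed.

End error_budget.

(** * Limits as the number of vectors grows *)

Section asymptotics.
Context (R : realType) (y : R) (hy : 0 < y)
  (p : nat -> nat) (hp : forall n, (0 < n)%N -> (0 < p n)%N)
  (hpy : (fun n => (p n)%:R / n%:R : R) @ \oo --> y)
  (d : measure_display) (T : measurableType d) (P : probability T R)
  (X : forall n, 'I_n -> {RV P >-> borelcV R (p n)})
  (nu : forall n, probability (borelcV R (p n)) R)
  (second_moments : forall n, (0 < n)%N -> forall a b : 'I_(p n),
    (\int[nu n]_z ((z : 'cV[R]_(p n)) a ord0 * (z : 'cV[R]_(p n)) b ord0)%:E =
     ((a == b)%:R / (p n)%:R)%:E)%E)
  (hindep : forall n, (0 < n)%N -> independent_family P (X n))
  (law : forall n, (0 < n)%N -> forall i B, measurable B -> P (X n i @^-1` B) = nu n B)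
  (l : nat) (hl : (0 < l)%N) (C : R) (C0 : 0 <= C)
  (hnorm : \forall n \near \oo,
    (\int[nu n]_z (`|enorm (z : 'cV[R]_(p n)) - 1| ^+ (2 * l))%:E <=
      (C * (p n)%:R^-1)%:E)%E)
  (hmax : forall eps : R, 0 < eps -> (fun n => P (simplex_event (X n) eps)) @ \oo --> 1%E)
  (f : R -> R) (hfm : measurable_fun (`[0, +oo[%classic : set R) f)
  (hf : times_differentiable_at l f 2).

Arguments X : clear implicits.

Let EA n t := \int[P]_w kernel_count f (X n) t w.
Let EB n t := \int[P]_w linear_count f (X n) t w.

Lemma near_pos : \forall n \near \oo, (0 < n)%N.
Proof. by exists 1%N. Qed.

(** Eventually [(p n)%:R / n%:R >= y / 2], so n/p is at most [2 / y]; inserting [D = C / p] in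
    [mean_dev_bound] gives this constant. *)
Let CY : R := 1 + 2 / y * (2 * C + 1).

Let CY0 : 0 < CY.
Proof. by rewrite addr_gt0// mulr_gt0 ?divr_gt0// ltr_wpDl// mulr_ge0. Qed.

Lemma near_mean_dev_bound :
  \forall n \near \oo, mean_dev_bound (p n) n (C * (p n)%:R^-1) <= CY.
Proof.
have y2 : 0 < y / 2 by rewrite divr_gt0.
have /cvgrPdist_lt /(_ _ y2) near_ratio := hpy.
near=> n.
have n0 : (0 < n)%N by near: n; exact: near_pos.
have n0R : 0 < n%:R :> R by rewrite ltr0n.
have p0R : 0 < (p n)%:R :> R by rewrite ltr0n hp.
have r : `|y - (p n)%:R / n%:R| < y / 2 by near: n.
have r1 : y / 2 <= (p n)%:R / n%:R by move: r; rewrite ltr_norml; lra.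
rewrite /mean_dev_bound lerD2l.
have -> : n%:R * (2 * (C / (p n)%:R) + (p n)%:R^-1) =
    ((p n)%:R / n%:R)^-1 * (2 * C + 1).
  by field; rewrite !gt_eqF.
rewrite ler_wpM2r//; first by rewrite addr_ge0// mulr_ge0.
have -> : 2 / y = (y / 2)^-1 by rewrite invf_div.
by rewrite lef_pV2// posrE divr_gt0.
Unshelve. all: by end_near. Qed.

Lemma near_simplex_defect (eps e : R) : 0 < eps -> 0 < e ->
  \forall n \near \oo, simplex_defect (X n) eps <= e.
Proof.
move=> eps0 e0; have /fine_cvg /cvgrPdist_le /(_ _ e0) := hmax eps0.
move=> near1; near=> n.
have : `|1 - fine (P (simplex_event (X n) eps))| <= e by near: n.
by apply: le_trans; exact: ler_norm.
Unshelve. all: by end_near. Qed.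

Lemma near_inv_le (s : nat) (e : R) : 0 < e -> \forall n \near \oo, s%:R / n%:R <= e.
Proof.
move=> e0; exists (Num.truncn (s%:R / e)).+1 => // n /= sn.
have n0 : 0 < n%:R :> R by rewrite ltr0n (leq_ltn_trans _ sn).
rewrite ler_pdivrMr// mulrC -ler_pdivrMr//.
by rewrite (le_trans (ltW (truncnS_gt _)))// ler_nat.
Qed.

Lemma near_expected_counts (t k e : R) : 0 < k -> 0 < e ->
  \forall n \near \oo, EA n t <= EB n (t + k) + e /\ EB n t <= EA n (t + k) + e.
Proof.
move=> k0 e0; have [s HS] := kernel_decomposition hl hf.
have k2 : 0 < k ^+ 2 by rewrite exprn_gt0.
(* Chosen so that [eta / k ^+ 2 * CY = e / 3]; the other two thirds go to the rank and to the bad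
   event. *)
pose eta := e / 3 * k ^+ 2 / CY.
have eta0 : 0 < eta by rewrite !(mulr_gt0, divr_gt0)// invr_gt0.
have [eps /andP[eps0 _] H] := HS _ eta0.
have e3 : 0 < e / 3 by rewrite divr_gt0.
have near_s := near_inv_le s e3.
have near_m := near_mean_dev_bound.
have near_d := near_simplex_defect eps0 e3.
near=> n.
have n0 : (0 < n)%N by near: n; exact: near_pos.
have hn : (\int[nu n]_z (`|enorm (z : 'cV[R]_(p n)) - 1| ^+ (2 * l))%:E <=
      (C * (p n)%:R^-1)%:E)%E by near: n.
have D0 : 0 <= C * (p n)%:R^-1 by rewrite mulr_ge0.
have [h1 h2] := compare_expected_counts hfm (second_moments n0) (hindep n0) (law n0)
  (hp n0) n0 D0 hn t k0 (ltW eta0) (H n (p n)).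
have b1 : s%:R / n%:R <= e / 3 by near: n.
have b2 : simplex_defect (X n) eps <= e / 3 by near: n.
have b3 : eta / k ^+ 2 * mean_dev_bound (p n) n (C * (p n)%:R^-1) <= e / 3.
  have -> : e / 3 = eta / k ^+ 2 * CY by rewrite /eta; field; rewrite !gt_eqF.
  apply: (ler_wpM2l (divr_ge0 (ltW eta0) (ltW k2))).
  by near: n.
by split; [exact: le_add_thirds h1 b1 b2 b3|exact: le_add_thirds h2 b1 b2 b3].
Unshelve. all: by end_near. Qed.

Lemma near_tight (e : R) : 0 < e -> exists K, \forall n \near \oo,
  EB n (- K) <= e /\ 1 - EB n K <= e.
Proof.
move=> e0; pose sc := linear_mx_scale f.
have sc0 : 0 <= sc by rewrite /sc /linear_mx_scale addr_ge0// mulr_ge0// sqr_ge0.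
have e2 : 0 < e / 2 by rewrite divr_gt0.
(* The summand 1 gives [K <= K ^+ 2], so dividing [sc * CY] by [K ^+ 2] already leaves at most
   [e / 2]. *)
pose K := 1 + sc * CY / (e / 2).
have scCY : 0 <= sc * CY by rewrite mulr_ge0// ltW.
have K1 : 1 <= K by rewrite lerDl divr_ge0// ltW.
have K0 : 0 < K by exact: lt_le_trans K1.
have K20 : 0 < K ^+ 2 by rewrite exprn_gt0.
exists K.
pose q : R := 4^-1.
have q0 : 0 < q by rewrite invr_gt0.
have near_d := near_simplex_defect q0 e2.
have near_m := near_mean_dev_bound.
near=> n.
have n0 : (0 < n)%N by near: n; exact: near_pos.
have hn : (\int[nu n]_z (`|enorm (z : 'cV[R]_(p n)) - 1| ^+ (2 * l))%:E <=
      (C * (p n)%:R^-1)%:E)%E by near: n.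
have D0 : 0 <= C * (p n)%:R^-1 by rewrite mulr_ge0.
have qq : 0 < q <= 4^-1 by rewrite q0 lexx.
have [h1 h2] := tight_linear_count f (second_moments n0) (hindep n0) (law n0)
  (hp n0) n0 D0 hn K0 qq.
have b2 : simplex_defect (X n) q <= e / 2 by near: n.
have b3 : sc / K ^+ 2 * mean_dev_bound (p n) n (C * (p n)%:R^-1) <= e / 2.
  apply: (@le_trans _ _ (sc / K ^+ 2 * CY)).
    apply: (ler_wpM2l (divr_ge0 sc0 (ltW K20))).
    by near: n.
  rewrite mulrAC ler_pdivrMr// [leRHS]mulrC -ler_pdivrMr//.
  apply: (@le_trans _ _ K); first by rewrite /K lerDr.
  by rewrite expr2 ler_peMr// ltW.
by split; [exact: le_halves h1 b2 b3|exact: le_halves h2 b2 b3].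
Unshelve. all: by end_near. Qed.

(** Rational thresholds keep the union of exceptional sets countable, which gives one null set for
    all of them. *)
Lemma ae_kernel_count_concentration :
  {ae P, forall w, forall q : rat,
    kernel_count f (X n) (ratr q) w - EA n (ratr q) @[n --> \oo] --> 0}.
Proof.
apply: ae_forall_rat => q.
apply: ae_cvg0 => [n|e e01].
  by apply: measurable_funB => //; exact: measurable_kernel_count.
exists (expR (- (e ^+ 2 / 16))).
  rewrite expR_gt0 expR_lt1 oppr_lt0 divr_gt0// exprn_gt0//.
  by case/andP: e01.
move=> n n0.
pose F : n.-tuple (borelcV R (p n)) -> R := kernel_cdf f (ratr q).
have mF : measurable_fun setT F by exact: measurable_kernel_cdf.
have F01 t : 0 <= F t <= 1 by apply: below_ratio_bounds; exact: kernel_mx_sym.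
have Fc : bounded_differences F (2 / n%:R) by exact: kernel_cdf_bounded_differences.
have kcE w : kernel_count f (X n) (ratr q) w = F [tuple X n i w | i < n].
  have xE : (fun i => tnth [tuple X n i w | i < n] i : 'cV[R]_(p n)) = (fun i => X n i w).
    by apply/funext => i; rewrite tnth_mktuple.
  by rewrite /F /kernel_cdf /kernel_count xE.
exact: (independent_mcdiarmid (hindep n0) (law n0) kcE mF F01 n0 Fc e01).
Qed.

Lemma kernel_gram_asymptotically_equal (m : nat -> T -> set (measurableTypeR R) -> \bar R)
    (v : nat -> set (measurableTypeR R) -> \bar R) :
  (forall n w, (0 < n)%N -> m n w = esd (kernel_mx f (fun i => X n i w : 'cV[R]_(p n)))) ->
  (forall n, (0 < n)%N -> v n = pushforward
     (mean_esd P (fun w => gram_mx (fun i => X n i w : 'cV[R]_(p n))))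
    ((fun s : R => f 0 - f 2 + 2 * derive1 f 2 - 2 * derive1 f 2 * s)
      : measurableTypeR R -> measurableTypeR R)) ->
  {ae P, forall w, asymptotically_weakly_equal (fun n => m n w) v}.
Proof.
move=> mE vE.
apply: filterS ae_kernel_count_concentration => w conc.
(* For [n = 0] the empirical distribution is the zero measure; a Dirac mass stands in, which does
   not affect the limit. *)
have /choice[qm qmE] n : exists q : probability (measurableTypeR R) R,
    (0 < n)%N -> (q : set _ -> _) = m n w.
  have [n0|] := posnP n; first by exists \d_(0 : measurableTypeR R); rewrite n0.
  move=> n0; rewrite mE//.
  have [q qE] := esd_probability n0 (kernel_mx_sym f (fun i => X n i w : 'cV[R]_(p n))).
  by exists q.
have /choice[qv qvE] n : exists q : probability (measurableTypeR R) R,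
    (0 < n)%N -> (q : set _ -> _) = v n.
  have [n0|] := posnP n; first by exists \d_(0 : measurableTypeR R); rewrite n0.
  move=> n0; rewrite vE//.
  have [||q qE] := mean_esd_pushforward_probability P
    (fun w => gram_mx_sym (fun i => X n i w : 'cV[R]_(p n))) _ n0 (phi := fun s : R =>
       f 0 - f 2 + 2 * derive1 f 2 - 2 * derive1 f 2 * s).
  - by move=> i j; exact: measurable_gram_entry.
  - by apply: measurable_funB => //; apply: measurable_funM.
  by exists q.
have cdfm n t : (0 < n)%N -> cdfR (qm n) t = kernel_count f (X n) t w.
  by move=> n0; rewrite /cdfR qmE// mE// esd_ray// kernel_mx_sym.
have cdfv n t : (0 < n)%N -> cdfR (qv n) t = EB n t.
  by move=> n0; rewrite /cdfR qvE// vE// mean_esd_affine_ray.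
have rat_between (a b : R) : a < b -> exists q : rat, a < ratr q < b.
  by move=> /rat_in_itvoo[q]; rewrite in_itv/=; exists q.
have near_conc (q : rat) (e : R) : 0 < e -> \forall n \near \oo,
    `|kernel_count f (X n) (ratr q) w - EA n (ratr q)| <= e.
  by move=> e0; have /cvgr0Pnorm_le := conc q; apply.
have weak : asymptotically_weakly_equal qm qv.
  apply: asymptotically_weakly_equal_cdf.
  - move=> t k e k0 e0.
    (* The shift is split at a rational [q]: from [t] to [q] by monotonicity on the random side,
       then from [q] to [t + k] by the comparison of expectations. The opposite inequality uses the
       two parts in the other order. *)
    have [q /andP[tq qt]] := rat_between t (t + k) ltac:(lra).
    have e2 : 0 < e / 2 by rewrite divr_gt0.
    have kq : 0 < t + k - ratr q by lra.
    have H := near_expected_counts (ratr q) kq e2.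
    have G := near_conc q _ e2.
    near=> n.
    have n0 : (0 < n)%N by near: n; exact: near_pos.
    have [h1 _] : EA n (ratr q) <= EB n (ratr q + (t + k - ratr q)) + e / 2 /\
        EB n (ratr q) <= EA n (ratr q + (t + k - ratr q)) + e / 2 by near: n.
    have h2 : `|kernel_count f (X n) (ratr q) w - EA n (ratr q)| <= e / 2 by near: n.
    have h3 : cdfR (qm n) t <= cdfR (qm n) (ratr q) by rewrite cdfR_mono// ltW.
    rewrite cdfv//; move: h1; rewrite (_ : ratr q + (t + k - ratr q) = t + k); last by ring.
    by move=> h1; apply: le_trans h3 _; rewrite cdfm//; exact: le_dist_halves h1 h2.
  - move=> t k e k0 e0.
    have [q /andP[tq qt]] := rat_between t (t + k) ltac:(lra).
    have e2 : 0 < e / 2 by rewrite divr_gt0.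
    have kq : 0 < ratr q - t by lra.
    have H := near_expected_counts t kq e2.
    have G := near_conc q _ e2.
    near=> n.
    have n0 : (0 < n)%N by near: n; exact: near_pos.
    have [_ h1] : EA n t <= EB n (t + (ratr q - t)) + e / 2 /\
        EB n t <= EA n (t + (ratr q - t)) + e / 2 by near: n.
    have h2 : `|kernel_count f (X n) (ratr q) w - EA n (ratr q)| <= e / 2 by near: n.
    have h3 : cdfR (qm n) (ratr q) <= cdfR (qm n) (t + k) by rewrite cdfR_mono// ltW.
    rewrite cdfv//; move: h1; rewrite (_ : t + (ratr q - t) = ratr q); last by ring.
    move: h3; rewrite (cdfm n (ratr q))// => h3 h1.
    exact: ge_dist_halves h1 h2 h3.
  - move=> e e0; have [K hK] := near_tight e0; exists K; near=> n.
    have n0 : (0 < n)%N by near: n; exact: near_pos.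
    by rewrite !cdfv//; near: n.
move=> g cg gb; apply: cvg_trans (weak g cg gb); apply: near_eq_cvg; near=> n.
have n0 : (0 < n)%N by near: n; exact: near_pos.
by rewrite -qmE// -qvE.
Unshelve. all: by end_near. Qed.

End asymptotics.
Theorem theorem4 (R : realType) (y : R) (hy : 0 < y)
  (p : nat -> nat) (hp : forall n, (0 < n)%N -> (0 < p n)%N)
  (hpy : (fun n => (p n)%:R / n%:R : R) @ \oo --> y)
  (dY : nat -> measure_display) (TY : forall n, measurableType (dY n))
  (Q : forall n, probability (TY n) R)
  (Y : forall n, {RV (Q n) >-> borelcV R (p n)})
  (hY : forall n, (0 < n)%N -> isotropic (Q n) (Y n))
  (d : measure_display) (T : measurableType d) (P : probability T R)
  (X : forall n, 'I_n -> {RV P >-> borelcV R (p n)})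
  (hindep : forall n, (0 < n)%N -> independent_family P (X n))
  (hcopies : forall n, (0 < n)%N -> forall (k : 'I_n) (B : set (borelcV R (p n))),
     measurable B -> distribution P (X n k) B = distribution (Q n) (Y n) B)
  (l : nat) (hl : (0 < l)%N)
  (hnorm : exists C : R, \forall n \near \oo,
     ('E_(Q n)[fun w => (`|enorm (Y n w) - 1| ^+ (2 * l)%N)%R]
        <= (C * (p n)%:R^-1)%:E)%E)
  (hmax : forall eps : R, 0 < eps ->
     (fun n => P [set w |
        \big[Num.max/0]_(ij : 'I_n * 'I_n | ij.1 != ij.2)
           Num.max
             `|enorm ((X n ij.1 w : 'cV[R]_(p n)) - X n ij.2 w) ^+ 2 - 2|
             `|enorm (X n ij.1 w) ^+ 2 - 1| <= eps]) @ \oo --> 1%E)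
  (f : R -> R) (hfm : measurable_fun (`[0, +oo[ : set R) f)
  (hf : times_differentiable_at l f 2) :
  let A (n : nat) (w : T) : 'M[R]_n :=
    \matrix_(i, j) f (enorm ((X n i w : 'cV[R]_(p n)) - X n j w) ^+ 2) in
  let Xmx (n : nat) (w : T) : 'M[R]_(p n, n) :=
    \matrix_(i, j) (X n j w : 'cV[R]_(p n)) i ord0 in
  let mu (n : nat) : set (measurableTypeR R) -> \bar R :=
    pushforward (mean_esd P (fun w => (Xmx n w)^T *m Xmx n w))
      (fun s : R => f 0 - f 2 + 2 * derive1 f 2 - 2 * derive1 f 2 * s) in
  {ae P, forall w, asymptotically_weakly_equal (fun n => esd (A n w)) mu}.
Proof.
move=> A Xmx mu.
pose nu n : probability (borelcV R (p n)) R := distribution (Q n) (Y n).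
have second_moments n : (0 < n)%N -> forall a b : 'I_(p n),
    (\int[nu n]_z ((z : 'cV[R]_(p n)) a ord0 * (z : 'cV[R]_(p n)) b ord0)%:E =
     ((a == b)%:R / (p n)%:R)%:E)%E.
  by move=> n0; apply: isotropic_second_moments; exact: hY.
have law n : (0 < n)%N -> forall i B, measurable B -> P (X n i @^-1` B) = nu n B.
  by move=> n0 i B mB; exact: hcopies.
have [C hC] := hnorm.
(* The constant [C] of the O-bound may be negative, hence the absolute value. *)
have hnu : \forall n \near \oo,
    (\int[nu n]_z (`|enorm (z : 'cV[R]_(p n)) - 1| ^+ (2 * l))%:E <=
      (`|C| * (p n)%:R^-1)%:E)%E.
  near=> n.
  have h : ('E_(Q n)[fun w => (`|enorm (Y n w) - 1| ^+ (2 * l)%N)%R]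
        <= (C * (p n)%:R^-1)%:E)%E by near: n.
  rewrite ge0_integral_distribution//; last first.
    apply/measurable_EFinP; apply: measurable_funX; apply: measurableT_comp => //.
    by apply: measurable_funB => //; exact: measurable_enorm.
  move: h; rewrite unlock => /le_trans; apply.
  by rewrite lee_fin ler_wpM2r// ler_norm.
have hsimplex (eps : R) : 0 < eps ->
    (fun n => P (simplex_event (X n) eps)) @ \oo --> 1%E.
  move=> eps0; apply: cvg_trans (hmax _ eps0); apply: near_eq_cvg.
  (* From two vectors on, the maximum in the hypothesis describes exactly the near-simplex event. *)
  exists 2%N => // n /= n2.
  by rewrite -(simplex_eventE (fun i => X n i) n2 (ltW eps0)).
have gramE n : (fun w => (Xmx n w)^T *m Xmx n w) =
    (fun w => gram_mx (fun i => X n i w : 'cV[R]_(p n))).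
  apply/funext => w; apply/matrixP => i j; rewrite !mxE.
  by apply: eq_bigr => k _; rewrite !mxE.
have vE n : (0 < n)%N -> mu n = pushforward
     (mean_esd P (fun w => gram_mx (fun i => X n i w : 'cV[R]_(p n))))
    ((fun s : R => f 0 - f 2 + 2 * derive1 f 2 - 2 * derive1 f 2 * s)
      : measurableTypeR R -> measurableTypeR R).
  by move=> _; rewrite /mu gramE.
exact: (@kernel_gram_asymptotically_equal _ _ hy _ hp hpy _ _ _ _ _ second_moments
  hindep law _ hl _ (normr_ge0 C) hnu hsimplex _ hfm hf (fun n w => esd (A n w)) mu
  (fun n w _ => erefl) vE).
Unshelve. all: by end_near. Qed.
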